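(* The norm of the Hilbert matrix operator $\mathcal{H}$ acting from $H^\infty$ to $\Lambda^{1,\ast}_{1}$ satisfies $$\frac{3}{2}+\frac{2}{\pi}\le\|\mathcal{H}\|_{H^\infty\to\Lambda^{1,\ast}_{1}}\le\frac{3}{2}+\frac{4}{\pi}.$$
   Context: Let $\mathbb{D}=\{z\in\mathbb{C}:|z|<1\}$ and let $H(\mathbb{D})$ be the space of all analytic functions on $\mathbb{D}$. $H^\infty$ is the space of $f\in H(\mathbb{D})$ with $\|f\|_\infty=\sup_{z\in\mathbb{D}}|f(z)|<\infty$. For $0\le r<1$ and $f\in H(\mathbb{D})$, $M_1(r,f)=\frac{1}{2\pi}\int_0^{2\pi}|f(re^{i\theta})|\,d\theta$. The Zygmund-type space $\Lambda^{1,\ast}_{1}$ consists of all $f\in H(\mathbb{D})$ with $$\|f\|_{\Lambda^{1,\ast}_{1}}=|f(0)|+|f'(0)|+\sup_{0<r<1}(1-r^2)M_1(r,f'')<\infty.$$ For $f(z)=\sum_{n=0}^\infty a_nz^n\in H(\mathbb{D})$, the Hilbert matrix operator is $$\mathcal{H}(f)(z)=\sum_{n=0}^\infty\left(\sum_{k=0}^\infty\frac{a_k}{n+k+1}\right)z^n,\quad z\in\mathbb{D},$$ whenever the right-hand side makes sense and defines an analytic function in $\mathbb{D}$. The operator norm is $\|\mathcal{H}\|_{H^\infty\to\Lambda^{1,\ast}_{1}}=\sup\{\|\mathcal{H}(f)\|_{\Lambda^{1,\ast}_{1}}: f\in H^\infty,\ \|f\|_\infty\le 1\}$. *)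

(* Defs.v *)
From Stdlib Require Import Reals.
From Coquelicot Require Import Coquelicot.

Local Open Scope R_scope.

Definition unit_disc (z : C) : Prop := Cmod z < 1.

(* Elements of the function spaces below are total functions on C of which only
   the values on the disc matter. *)
Definition analytic_on_disc (f : C -> C) : Prop :=
  forall z : C, unit_disc z -> @ex_derive C_AbsRing C_NormedModule f z.

Definition power_series_on_disc (a : nat -> C) (f : C -> C) : Prop :=
  forall z : C, unit_disc z -> @is_pseries C_AbsRing C_NormedModule a z (f z).

Definition Hinf_norm (f : C -> C) : Rbar :=
  Lub_Rbar (fun x : R => exists z : C, unit_disc z /\ x = Cmod (f z)).

Definition in_Hinf (f : C -> C) : Prop :=
  analytic_on_disc f /\ Rbar_lt (Hinf_norm f) p_infty.

Definition M1 (r : R) (f : C -> C) : R :=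
  / (2 * PI) *
  RInt (fun t : R => Cmod (f (r * cos t, r * sin t))) 0 (2 * PI).

Definition Zygmund_norm (f : C -> C) : Rbar :=
  Rbar_plus
    (Finite (Cmod (f (RtoC 0)) + Cmod (C_derive f (RtoC 0))))
    (Lub_Rbar (fun x : R => exists r : R,
       0 < r < 1 /\ x = (1 - r ^ 2) * M1 r (C_derive (C_derive f)))).

Definition in_Zygmund (f : C -> C) : Prop :=
  analytic_on_disc f /\ Rbar_lt (Zygmund_norm f) p_infty.

(* The graph of the Hilbert matrix operator: [is_hilbert f g] holds when the
   right-hand side defining the image of [f] makes sense, is analytic in the
   disc, and [g] is its sum there. *)
Definition is_hilbert (f g : C -> C) : Prop :=
  analytic_on_disc f /\ analytic_on_disc g /\
  exists a b : nat -> C,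
    power_series_on_disc a f /\
    (forall n : nat,
       @is_series C_AbsRing C_NormedModule
         (fun k : nat => Cdiv (a k) (RtoC (INR (n + k + 1)))) (b n)) /\
    power_series_on_disc b g.

Definition hilbert_norm_Hinf_Zygmund : Rbar :=
  Rbar_lub (fun N : Rbar => exists f g : C -> C,
    in_Hinf f /\ Rbar_le (Hinf_norm f) (Finite 1) /\
    is_hilbert f g /\ N = Zygmund_norm g).

(* Main.v *)
Require Import Defs.
From Stdlib Require Import Reals Lra Lia.
From Coquelicot Require Import Coquelicot.

(** Let f be bounded by M on the disc and let g be its image. The n-th Taylor
    coefficient of g is b_n = int_0^1 t^n f(t) dt, so |g(0)| <= M, |g'(0)| <= M / 2 and
      g''(z) = int_0^1 2 t^2 f(t) / (1 - t z)^3 dt.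

    Upper bound. Since t^2 <= t, |g''(z)| is at most M times the integral of
    2 t / |1 - t z|^3 over [0,1], which is elementary: with d = |1 - z| it equals
      kernel z = 2 / (d (d + 1 - Re z)).
    On the half circle z = r e^(i th), 0 <= th <= pi, one has
    1 - Re z >= 1 - r >= (1 - r) cos (th/2), and 2 / (d (d + (1 - r) cos (th/2))) is
    the derivative in th of
      4 / (1 - r) * sin (th/2) / ((1 - r) cos (th/2) + d),
    which grows from 0 to 4 / (1 - r^2). The two half circles together give
    (1 - r^2) M_1(r, g'') <= 4 M / pi, hence the constant 3/2 + 4/pi
    ([Cmod_second_derivative_le], [RInt_circle_le], [Zygmund_norm_hilbert_le]).

    The integrals over [0,1] are never formed. A finite combination
    p_0 b_0 + ... + p_N b_N is the sum at s = 1 of a power series in s that vanishes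
    at 0 and has derivative (p_0 + ... + p_N s^N) f(s) on [0,1). A bound G' for the
    modulus of this derivative bounds the combination by G(1) - G(0), by the mean
    value inequality on [0,s] and Abel's theorem as s tends to 1 ([moment_bound]).

    Existence of the image. Integrating |f|^2 over circles shows that the a_k are
    square summable ([Bessel_inequality]), so the series defining b_n converge
    absolutely; then |b_n| <= M / (n + 1) makes g analytic.

    Lower bound. For f = 1 one has b_n = 1 / (n + 1), so |g(0)| + |g'(0)| = 3/2 and
      g''(z) = z / (1 - z)^2 + 2 sum z^n / (n + 3).
    The first term has modulus r / |1 - z|^2, a multiple of the Poisson kernel whose
    mean multiplied by 1 - r^2 is r, while the weighted mean of the second term
    tends to 0 as r tends to 1; at r = 999/1000 the value already exceeds 2/pi
    ([Zygmund_norm_reciprocals_ge]). *)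

Local Open Scope R_scope.

(** * Complex series *)

Notation is_Cseries := (@is_series C_AbsRing C_NormedModule).
Notation ex_Cseries := (@ex_series C_AbsRing C_NormedModule).
Notation is_Cderive := (@is_derive C_AbsRing C_NormedModule).
Notation Csum_n := (@sum_n C_AbelianMonoid).

Lemma Re_sum_n (u : nat -> C) n : Re (Csum_n u n) = sum_n (fun k => Re (u k)) n.
Proof.
induction n as [|n IH]; [now rewrite !sum_O|].
rewrite !sum_Sn, <- IH; reflexivity.
Qed.

Lemma Im_sum_n (u : nat -> C) n : Im (Csum_n u n) = sum_n (fun k => Im (u k)) n.
Proof.
induction n as [|n IH]; [now rewrite !sum_O|].
rewrite !sum_Sn, <- IH; reflexivity.
Qed.

(** The topology of [C] is the product topology, so real theorems (notably Abel's) transfer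
    to complex series one component at a time. *)
Lemma is_Cseries_components (u : nat -> C) (l : C) :
  is_Cseries u l <->
  is_series (fun n => Re (u n)) (Re l) /\ is_series (fun n => Im (u n)) (Im l).
Proof.
split.
- intros H.
  assert (H' := proj1 (filterlim_locally (U := C_UniformSpace) (sum_n u) l) H).
  split; apply filterlim_locally; intros eps; generalize (H' eps);
    apply filter_imp; intros n [H1 H2].
  + rewrite <- Re_sum_n; exact H1.
  + rewrite <- Im_sum_n; exact H2.
- intros [H1 H2].
  apply (filterlim_locally (U := C_UniformSpace) (sum_n u) l); intros eps.
  generalize (filter_and _ _ (proj1 (filterlim_locally _ _) H1 eps)
                             (proj1 (filterlim_locally _ _) H2 eps)).
  apply filter_imp; intros n; rewrite <- Re_sum_n, <- Im_sum_n; exact (fun H => H).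
Qed.

Lemma is_lim_seq_Cmod (u : nat -> C) (l : C) :
  is_Cseries u l -> is_lim_seq (fun n => Cmod (Csum_n u n)) (Cmod l).
Proof.
intros H.
apply (filterlim_comp _ _ _ (sum_n u) (@norm C_AbsRing C_NormedModule) _ (locally l)).
exact H. apply (filterlim_norm l).
Qed.

Lemma is_Cseries_single (u : nat -> C) (l : C) : u O = l ->
  (forall n, u (S n) = RtoC 0) -> is_Cseries u l.
Proof.
intros <- Hu; apply (is_series_decr_1 (V := C_NormedModule)).
apply (is_series_ext (fun _ => RtoC 0)); [now intros n|].
replace (plus _ _) with (RtoC 0).
- apply (filterlim_ext (fun _ : nat => RtoC 0)).
  + intros n; symmetry; apply (sum_n_m_const_zero (G := C_AbelianMonoid)).
  + apply filterlim_const.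
- change (RtoC 0 = u O - u O)%C; ring.
Qed.

Lemma Cmod_sum_n_le (u : nat -> C) (v : nat -> R) n :
  (forall k, Cmod (u k) <= v k) -> Cmod (Csum_n u n) <= sum_n v n.
Proof.
intros H; induction n as [|n IH]; [now rewrite !sum_O|].
rewrite !sum_Sn; apply (Rle_trans _ _ _ (Cmod_triangle _ _)).
apply Rplus_le_compat; [exact IH|apply H].
Qed.

Lemma Cmod_series_le (u : nat -> C) (l : C) (v : nat -> R) (m : R) :
  is_Cseries u l -> is_series v m -> (forall n, Cmod (u n) <= v n) -> Cmod l <= m.
Proof.
intros Hu Hv H.
apply (is_lim_seq_le (fun n => Cmod (Csum_n u n)) (sum_n v) (Cmod l) m).
- intros n; now apply Cmod_sum_n_le.
- now apply is_lim_seq_Cmod.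
- exact Hv.
Qed.

Lemma ex_Cseries_le (u : nat -> C) (v : nat -> R) :
  (forall n, Cmod (u n) <= v n) -> ex_series v -> ex_Cseries u.
Proof. exact (@ex_series_le C_AbsRing C_CompleteNormedModule u v). Qed.

Lemma is_Cseries_unique (u : nat -> C) (l1 l2 : C) :
  is_Cseries u l1 -> is_Cseries u l2 -> l1 = l2.
Proof. exact (filterlim_locally_unique (F := eventually) (V := C_NormedModule) (sum_n u) l1 l2). Qed.

Lemma Cseries_terms_bounded (u : nat -> C) :
  ex_Cseries u -> exists M, forall n, Cmod (u n) <= M.
Proof.
intros [l Hl].
destruct (filterlim_bounded (V := C_NormedModule) (sum_n u)) as [M HM].
{ now exists l. }
change (forall n, Cmod (Csum_n u n) <= M) in HM.
exists (M + M); intros [|n].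
- generalize (HM O) (Cmod_ge_0 (Csum_n u 0)); rewrite sum_O; lra.
- replace (u (S n)) with (Csum_n u (S n) - Csum_n u n)%C.
  2:{ rewrite sum_Sn; unfold plus; simpl; ring. }
  apply (Rle_trans _ _ _ (Cmod_triangle _ _)); rewrite Cmod_opp.
  apply Rplus_le_compat; apply HM.
Qed.

(** A total sum operator on complex sequences, so that power series and their derivatives can
    be handled as functions. *)
Definition Csum (u : nat -> C) : C := (Series (fun n => Re (u n)), Series (fun n => Im (u n))).

Lemma Csum_correct (u : nat -> C) : ex_Cseries u -> is_Cseries u (Csum u).
Proof.
intros [l Hl]; apply is_Cseries_components in Hl; destruct Hl as [H1 H2].
apply is_Cseries_components; split; apply Series_correct; eexists; eassumption.
Qed.

Lemma Csum_unique (u : nat -> C) l : is_Cseries u l -> Csum u = l.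
Proof.
intros H; apply (is_Cseries_unique u); [|exact H].
apply Csum_correct; now exists l.
Qed.

Lemma Cmod_series_tail_le (u : nat -> C) (l : C) (v : nat -> R) (m : R) N :
  is_Cseries u l -> is_series v m -> (forall n, Cmod (u n) <= v n) ->
  Cmod (l - Csum_n u N) <= m - sum_n v N.
Proof.
intros Hu Hv H.
apply (Cmod_series_le (fun k => u (S N + k)%nat) _ (fun k => v (S N + k)%nat)).
- apply (is_series_incr_n (V := C_NormedModule)); [lia|].
  replace (plus _ _) with l; [exact Hu|].
  change (l = l - Csum_n u N + Csum_n u N)%C; ring.
- apply (is_series_incr_n (V := R_NormedModule)); [lia|].
  replace (plus _ _) with m; [exact Hv|].
  change (m = m - sum_n v N + sum_n v N); ring.
- intros n; apply H.
Qed.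

Lemma Cmod_reverse_triangle (P Q : C) : Cmod P - Cmod Q <= Cmod (P + Q).
Proof.
generalize (Cmod_triangle (P + Q) (- Q)); rewrite Cmod_opp.
replace (P + Q + - Q)%C with P by ring; lra.
Qed.

(** * Power series on the unit disc *)

Definition CPS (a : nat -> C) (z : C) : C := Csum (fun n => a n * z ^ n)%C.

Definition conv_disc (a : nat -> C) : Prop :=
  forall z, unit_disc z -> ex_Cseries (fun n => a n * z ^ n)%C.

Lemma CPS_correct a z : conv_disc a -> unit_disc z ->
  is_Cseries (fun n => a n * z ^ n)%C (CPS a z).
Proof. intros Ha Hz; apply Csum_correct, Ha, Hz. Qed.

Lemma bounded_conv_disc (c : nat -> C) (M : R) : (forall n, Cmod (c n) <= M) -> conv_disc c.
Proof.
intros HM z Hz; apply (ex_Cseries_le _ (fun n => M * Cmod z ^ n)).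
- intros n; rewrite Cmod_mult, Cmod_pow; apply Rmult_le_compat_r; [apply pow_le, Cmod_ge_0|apply HM].
- apply (ex_series_scal_l M (fun n => Cmod z ^ n)), ex_series_geom.
  rewrite Rabs_pos_eq by apply Cmod_ge_0; exact Hz.
Qed.

Lemma is_Cseries_conv_disc (c : nat -> C) : ex_Cseries c -> conv_disc c.
Proof.
intros Hc; destruct (Cseries_terms_bounded c Hc) as [M HM]; exact (bounded_conv_disc c M HM).
Qed.

Lemma pow_n_Cpow (z : C) n : @pow_n C_Ring z n = (z ^ n)%C.
Proof. induction n as [|n IH]; [reflexivity|]. simpl; rewrite IH; reflexivity. Qed.

Lemma is_pseries_Cseries (a : nat -> C) (z l : C) :
  @is_pseries C_AbsRing C_NormedModule a z l <-> is_Cseries (fun n => a n * z ^ n)%C l.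
Proof.
assert (E : forall n, @scal C_AbsRing C_NormedModule (@pow_n C_Ring z n) (a n) = (a n * z ^ n)%C).
{ intros n; rewrite (pow_n_Cpow z n); apply Cmult_comm. }
split; apply is_series_ext; intros n; [apply E|symmetry; apply E].
Qed.

(** If the radius R of the moduli were below 1, the terms would be bounded at a point of
    ]R,1[, against the characterization of the radius by bounded terms. *)
Lemma conv_disc_radius a : conv_disc a -> Rbar_le 1 (CV_radius (fun n => Cmod (a n))).
Proof.
intros Ha; destruct (CV_radius_bounded (fun n => Cmod (a n))) as [Hub _].
apply Rbar_not_lt_le; intros Hlt.
assert (H0 : Rbar_le 0 (CV_radius (fun n => Cmod (a n)))) by apply CV_radius_ge_0.
destruct (CV_radius (fun n => Cmod (a n))) as [R| |]; simpl in Hlt, H0; try easy.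
set (x := (R + 1) / 2).
assert (Hx : R < x < 1) by (unfold x; lra).
assert (Rbar_le x R); [|simpl in *; lra].
apply Hub.
destruct (Cseries_terms_bounded (fun n => a n * (RtoC x) ^ n)%C) as [M HM].
{ apply Ha; unfold unit_disc; rewrite Cmod_R, Rabs_pos_eq; lra. }
exists M; intros n; generalize (HM n).
rewrite Cmod_mult, Cmod_pow, Cmod_R.
now rewrite Rabs_mult, (Rabs_pos_eq (Cmod _)), RPow_abs by apply Cmod_ge_0.
Qed.

Lemma radius_ex_series (b : nat -> R) x : Rbar_le 1 (CV_radius b) -> 0 <= x < 1 ->
  ex_series (fun n => b n * x ^ n).
Proof.
intros Hb Hx; apply ex_pseries_R, CV_radius_inside.
apply (Rbar_lt_le_trans _ 1); [simpl; rewrite Rabs_pos_eq; lra|exact Hb].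
Qed.

Lemma radius_conv_disc (a : nat -> C) (b : nat -> R) :
  (forall n, Cmod (a n) <= b n) -> Rbar_le 1 (CV_radius b) -> conv_disc a.
Proof.
intros Hab Hb z Hz.
apply (ex_Cseries_le _ (fun n => b n * Cmod z ^ n)).
- intros n; rewrite Cmod_mult, Cmod_pow.
  apply Rmult_le_compat_r; [apply pow_le, Cmod_ge_0|apply Hab].
- apply radius_ex_series; [exact Hb|split; [apply Cmod_ge_0|exact Hz]].
Qed.

Definition Cderiv (a : nat -> C) : nat -> C := fun n => (RtoC (INR (S n)) * a (S n))%C.

Lemma Cmod_Cderiv a n : Cmod (Cderiv a n) = PS_derive (fun k => Cmod (a k)) n.
Proof.
unfold Cderiv, PS_derive; rewrite Cmod_mult, Cmod_R, Rabs_pos_eq; [reflexivity|apply pos_INR].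
Qed.

Lemma conv_disc_Cderiv a : conv_disc a -> conv_disc (Cderiv a).
Proof.
intros Ha; apply (radius_conv_disc _ (PS_derive (fun k => Cmod (a k)))).
- intros n; rewrite Cmod_Cderiv; lra.
- rewrite CV_radius_derive; now apply conv_disc_radius.
Qed.

(** A quadratic remainder is what the Taylor expansion of a power series provides. *)
Lemma is_Cderive_quadratic (f : C -> C) (z l : C) (M delta : R) :
  0 < delta ->
  (forall w, Cmod (w - z) < delta ->
     Cmod (f w - f z - (w - z) * l) <= M * Cmod (w - z) ^ 2) ->
  is_Cderive f z l.
Proof.
intros Hd H; split.
{ apply is_linear_scal_l. }
intros x Hx.
rewrite <- (is_filter_lim_locally_unique (V := AbsRing_NormedModule C_AbsRing) z x Hx); clear x Hx.
intros eps.
assert (HM : 0 < Rabs M + 1) by (generalize (Rabs_pos M); lra).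
assert (Hm : 0 < Rmin delta (eps / (Rabs M + 1))).
{ apply Rmin_pos; [exact Hd|apply Rdiv_lt_0_compat; [apply cond_pos|exact HM]]. }
exists (mkposreal _ Hm); intros w Hw.
change (Cmod (w - z) < Rmin delta (eps / (Rabs M + 1))) in Hw.
change (Cmod (f w - f z - (w - z) * l) <= eps * Cmod (w - z)).
generalize (Rmin_l delta (eps / (Rabs M + 1))) (Rmin_r delta (eps / (Rabs M + 1))); intros H1 H2.
apply (Rle_trans _ (M * Cmod (w - z) ^ 2)); [apply H; lra|].
simpl; rewrite Rmult_1_r, <- Rmult_assoc.
apply Rmult_le_compat_r; [apply Cmod_ge_0|].
apply (Rle_trans _ ((Rabs M + 1) * (eps / (Rabs M + 1)))); [|right; field; lra].
generalize (Rle_abs M) (Cmod_ge_0 (w - z)); intros; nra.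
Qed.

(** The remainder E_n of the first order expansion of w^n at z satisfies
    E_(n+1) = w E_n + n z^(n-1) (w - z)^2, hence the bound by induction. *)
Lemma Cmod_pow_taylor (z w : C) (x : R) n : Cmod z <= x -> Cmod w <= x ->
  Cmod (w ^ S (S n) - z ^ S (S n) - RtoC (INR (S (S n))) * z ^ S n * (w - z))
    <= INR (S n) * INR (S (S n)) * x ^ n * Cmod (w - z) ^ 2.
Proof.
intros Hz Hw.
assert (Hx : 0 <= x) by (generalize (Cmod_ge_0 z); lra).
induction n as [|n IH].
- replace (w ^ 2 - z ^ 2 - RtoC (INR 2) * z ^ 1 * (w - z))%C with ((w - z) ^ 2)%C.
  + rewrite Cmod_pow; simpl; generalize (Cmod_ge_0 (w - z)); intros; nra.
  + simpl INR; rewrite RtoC_plus; simpl; ring.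
- replace (w ^ S (S (S n)) - z ^ S (S (S n)) - RtoC (INR (S (S (S n)))) * z ^ S (S n) * (w - z))%C
   with (w * (w ^ S (S n) - z ^ S (S n) - RtoC (INR (S (S n))) * z ^ S n * (w - z))
         + RtoC (INR (S (S n))) * z ^ S n * (w - z) ^ 2)%C.
  2:{ rewrite (S_INR (S (S n))), RtoC_plus; simpl; ring. }
  apply (Rle_trans _ _ _ (Cmod_triangle _ _)).
  rewrite !Cmod_mult, !Cmod_pow, Cmod_R, Rabs_pos_eq by apply pos_INR.
  apply (Rle_trans _ (x * (INR (S n) * INR (S (S n)) * x ^ n * Cmod (w - z) ^ 2)
    + INR (S (S n)) * x ^ S n * Cmod (w - z) ^ 2)).
  + apply Rplus_le_compat.
    * apply Rmult_le_compat; try apply Cmod_ge_0; assumption.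
    * apply Rmult_le_compat_r; [apply pow2_ge_0|].
      apply Rmult_le_compat_l; [apply pos_INR|apply pow_incr; split; [apply Cmod_ge_0|exact Hz]].
  + rewrite (S_INR (S (S n))), !(S_INR (S n)), !S_INR.
    assert (0 <= x ^ S n * Cmod (w - z) ^ 2) by (apply Rmult_le_pos; [now apply pow_le|apply pow2_ge_0]).
    generalize (pos_INR n); intros; simpl in *; nra.
Qed.

(** The quadratic remainders of the monomials sum up to a quadratic remainder, because the
    second derivative of the series of moduli converges at a radius x strictly between
    |z| and 1. *)
Lemma is_Cderive_CPS a z : conv_disc a -> unit_disc z -> is_Cderive (CPS a) z (CPS (Cderiv a) z).
Proof.
intros Ha Hz.
assert (Ha' := conv_disc_Cderiv a Ha).
unfold unit_disc in Hz.
set (x := (Cmod z + 1) / 2).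
assert (Hx : Cmod z < x < 1) by (unfold x; lra).
assert (Hx0 : 0 <= x) by (generalize (Cmod_ge_0 z); lra).
assert (HS : ex_series (fun n => PS_derive (PS_derive (fun k => Cmod (a k))) n * x ^ n)).
{ apply radius_ex_series; [|lra].
  rewrite !CV_radius_derive; now apply conv_disc_radius. }
apply (is_Cderive_quadratic _ _ _ (Series (fun n => PS_derive (PS_derive (fun k => Cmod (a k))) n * x ^ n)) (x - Cmod z)); [lra|].
intros w Hw.
assert (Hwx : Cmod w <= x).
{ replace w with (z + (w - z))%C by ring.
  apply (Rle_trans _ _ _ (Cmod_triangle _ _)); lra. }
rewrite <- Series_scal_r.
assert (Hfw := CPS_correct a w Ha ltac:(unfold unit_disc; lra)).
assert (Hfz := CPS_correct a z Ha Hz).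
assert (Hf' := CPS_correct _ z Ha' Hz).
apply (is_series_scal (w - z)%C) in Hf'.
assert (H1 : is_Cseries (fun n => a (S n) * w ^ S n - a (S n) * z ^ S n)%C (CPS a w - CPS a z)%C).
{ apply (is_series_incr_1 (V := C_NormedModule) (fun n => a n * w ^ n - a n * z ^ n)%C).
  replace (plus _ _) with (CPS a w - CPS a z)%C.
  apply (is_series_minus (V := C_NormedModule)); assumption.
  unfold plus; simpl; ring. }
assert (H2 := is_series_minus _ _ _ _ H1 Hf').
assert (H3 : is_Cseries (fun n => a (S (S n)) * (w ^ S (S n) - z ^ S (S n) - RtoC (INR (S (S n))) * z ^ S n * (w - z)))%C
    (CPS a w - CPS a z - (w - z) * CPS (Cderiv a) z)%C).
{ apply (is_series_incr_1 (V := C_NormedModule)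
    (fun n => a (S n) * (w ^ S n - z ^ S n - RtoC (INR (S n)) * z ^ n * (w - z)))%C).
  replace (plus _ _) with (CPS a w - CPS a z - (w - z) * CPS (Cderiv a) z)%C.
  2:{ unfold plus; simpl; ring. }
  refine (is_series_ext _ _ _ _ H2).
  intros n; unfold Cderiv, plus, opp, scal; simpl; unfold mult; simpl; ring. }
apply (Cmod_series_le _ _ _ _ H3 (Series_correct _ (ex_series_scal_r (Cmod (w - z) ^ 2) _ HS))).
intros n; rewrite Cmod_mult; unfold PS_derive.
apply (Rle_trans _ (Cmod (a (S (S n))) * (INR (S n) * INR (S (S n)) * x ^ n * Cmod (w - z) ^ 2))).
- apply Rmult_le_compat_l; [apply Cmod_ge_0|apply Cmod_pow_taylor; lra].
- right; ring.
Qed.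

(** * Bounding a sum by the derivative of its power series *)

(** Brings a complex derivative on the real axis back to real functions, where the mean value
    theorem is available. *)
Lemma is_derive_Re_Cderive (f : C -> C) (c l : C) (t : R) :
  is_Cderive f (RtoC t) l ->
  is_derive (fun x : R => Re (c * f (RtoC x))) t (Re (c * l)).
Proof.
intros [_ H]; split; [apply is_linear_scal_l|].
intros x Hx; rewrite <- (is_filter_lim_locally_unique t x Hx); clear x Hx.
intros eps.
assert (Hc : 0 < Cmod c + 1) by (generalize (Cmod_ge_0 c); lra).
assert (He : 0 < eps / (Cmod c + 1)) by (apply Rdiv_lt_0_compat; [apply cond_pos|exact Hc]).
destruct (H (RtoC t) (fun P p => p) (mkposreal _ He)) as [d Hd].
exists d; intros x Hx.
change (Rabs (x - t) < d) in Hx.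
change (Rabs (Re (c * f (RtoC x)) - Re (c * f (RtoC t)) - (x - t) * Re (c * l)) <= eps * Rabs (x - t)).
specialize (Hd (RtoC x)).
change (Cmod (RtoC x - RtoC t) < d ->
  Cmod (f (RtoC x) - f (RtoC t) - (RtoC x - RtoC t) * l)
   <= eps / (Cmod c + 1) * Cmod (RtoC x - RtoC t)) in Hd.
rewrite <- RtoC_minus, Cmod_R in Hd; specialize (Hd Hx).
replace (Re (c * f (RtoC x)) - Re (c * f (RtoC t)) - (x - t) * Re (c * l))
  with (Re (c * (f (RtoC x) - f (RtoC t) - RtoC (x - t) * l))).
2:{ unfold Re, RtoC; destruct c, l, (f (x, 0)), (f (t, 0)); simpl; ring. }
apply (Rle_trans _ _ _ (re_le_Cmod _)); rewrite Cmod_mult.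
apply (Rle_trans _ (Cmod c * (eps / (Cmod c + 1) * Rabs (x - t)))).
- apply Rmult_le_compat_l; [apply Cmod_ge_0|exact Hd].
- replace (Cmod c * (eps / (Cmod c + 1) * Rabs (x - t)))
    with ((eps * Rabs (x - t)) * (Cmod c / (Cmod c + 1))) by (field; lra).
  rewrite <- (Rmult_1_r (eps * Rabs (x - t))) at 2.
  apply Rmult_le_compat_l.
  + apply Rmult_le_pos; [left; apply cond_pos|apply Rabs_pos].
  + apply (Rmult_le_reg_r (Cmod c + 1)); [lra|]; field_simplify; lra.
Qed.

(** With w the increment of f, the mean value theorem is applied to the real function
    |w| G - Re (conj w * f), which has a nonnegative derivative; its increment is
    |w| (G s - G 0) - |w|^2. *)
Lemma Cmod_mean_value (f f' : C -> C) (G G' : R -> R) (s : R) : 0 <= s ->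
  (forall t, 0 <= t <= s -> is_Cderive f (RtoC t) (f' (RtoC t))) ->
  (forall t, 0 <= t <= s -> is_derive G t (G' t)) ->
  (forall t, 0 <= t <= s -> Cmod (f' (RtoC t)) <= G' t) ->
  Cmod (f (RtoC s) - f (RtoC 0)) <= G s - G 0.
Proof.
intros Hs Hf HG Hle.
set (w := (f (RtoC s) - f (RtoC 0))%C).
set (h := fun t => Cmod w * G t - Re (Cconj w * f (RtoC t))).
set (h' := fun t => Cmod w * G' t - Re (Cconj w * f' (RtoC t))).
assert (Hh : forall t, 0 <= t <= s -> is_derive h t (h' t)).
{ intros t Ht; apply (is_derive_minus (V := R_NormedModule)).
  - apply (is_derive_scal G); now apply HG.
  - now apply is_derive_Re_Cderive, Hf. }
destruct (MVT_gen h 0 s h') as [c [Hc E]].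
{ intros t Ht; rewrite Rmin_left, Rmax_right in Ht by lra; apply Hh; lra. }
{ intros t Ht; rewrite Rmin_left, Rmax_right in Ht by lra.
  apply derivable_continuous_pt; exists (h' t); apply is_derive_Reals, Hh; lra. }
rewrite Rmin_left, Rmax_right in Hc by lra.
assert (Hc' : 0 <= h' c).
{ unfold h'; generalize (re_le_Cmod (Cconj w * f' (RtoC c))).
  rewrite Cmod_mult, Cmod_conj.
  generalize (Rle_abs (Re (Cconj w * f' (RtoC c)))) (Hle c Hc) (Cmod_ge_0 w); intros; nra. }
assert (Ew : Re (Cconj w * f (RtoC s)) - Re (Cconj w * f (RtoC 0)) = Cmod w ^ 2).
{ rewrite Cmod2_alt; unfold w.
  destruct (f (RtoC s)), (f (RtoC 0)); unfold Re, Im, Cconj; simpl; ring. }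
unfold h in E.
assert (E2 : Cmod w * (G s - G 0) - Cmod w ^ 2 = h' c * (s - 0)) by (rewrite <- E, <- Ew; ring).
assert (H0 : 0 <= h' c * (s - 0)) by (apply Rmult_le_pos; lra).
destruct (Req_dec (Cmod w) 0) as [E0|E0].
- rewrite E0.
  destruct (MVT_gen G 0 s G') as [x [Hx Ex]].
  { intros t Ht; rewrite Rmin_left, Rmax_right in Ht by lra; apply HG; lra. }
  { intros t Ht; rewrite Rmin_left, Rmax_right in Ht by lra.
    apply derivable_continuous_pt; exists (G' t); apply is_derive_Reals, HG; lra. }
  rewrite Rmin_left, Rmax_right in Hx by lra.
  rewrite Ex; apply Rmult_le_pos; [|lra].
  apply (Rle_trans _ _ _ (Cmod_ge_0 _) (Hle x Hx)).
- generalize (Cmod_ge_0 w); intros; nra.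
Qed.

(** If the radius is 1 this is Abel's theorem; if it is larger, the sum is continuous at 1. *)
Lemma Series_Abel (u : nat -> R) (l : R) : is_series u l ->
  filterlim (PSeries u) (at_left 1) (locally l).
Proof.
intros H.
assert (Hl : PSeries u 1 = l).
{ rewrite <- (is_series_unique _ _ H); apply Series_ext; intros n; rewrite pow1; ring. }
assert (Hex : ex_pseries u 1) by (apply ex_pseries_1; now exists l).
assert (Hr : Rbar_le 1 (CV_radius u)).
{ apply Rbar_not_lt_le; intros Hlt; rewrite <- (Rabs_pos_eq 1) in Hlt by lra.
  apply (CV_disk_outside u 1 Hlt).
  apply (is_lim_seq_ext u); [intros n; rewrite pow1; ring|].
  apply ex_series_lim_0; now exists l. }
destruct (Rbar_le_lt_or_eq_dec _ _ Hr) as [Hlt|Heq].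
- rewrite <- Hl; apply (filterlim_filter_le_1 (F := locally 1) (PSeries u)); [apply filter_le_within|].
  apply continuity_pt_filterlim, PSeries_continuity; now rewrite Rabs_pos_eq by lra.
- assert (HA := Abel u); rewrite <- Heq in HA; rewrite <- Hl.
  apply HA; [simpl; lra|exact I|exact Hex].
Qed.

Lemma Re_mult_R (c : C) (x : R) : Re (c * RtoC x) = Re c * x.
Proof. destruct c; unfold Re, RtoC; simpl; ring. Qed.

Lemma Im_mult_R (c : C) (x : R) : Im (c * RtoC x) = Im c * x.
Proof. destruct c; unfold Im, RtoC; simpl; ring. Qed.

Lemma CPS_real (c : nat -> C) (t : R) :
  CPS c (RtoC t) = (PSeries (fun n => Re (c n)) t, PSeries (fun n => Im (c n)) t).
Proof.
unfold CPS, Csum, PSeries; f_equal; apply Series_ext; intros n; rewrite <- RtoC_pow;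
 [apply Re_mult_R|apply Im_mult_R].
Qed.

Lemma Cseries_Abel_bound (c : nat -> C) (l : C) (B : R) : is_Cseries c l ->
  (forall s, 0 <= s < 1 -> Cmod (CPS c (RtoC s)) <= B) -> Cmod l <= B.
Proof.
intros H HB.
destruct (proj1 (is_Cseries_components c l) H) as [H1 H2].
assert (Hlim : filterlim (fun s : R => CPS c (RtoC s)) (at_left 1) (locally (T := C_UniformSpace) l)).
{ apply (filterlim_locally (U := C_UniformSpace)); intros eps.
  generalize (filter_and _ _ (proj1 (filterlim_locally _ _) (Series_Abel _ _ H1) eps)
                             (proj1 (filterlim_locally _ _) (Series_Abel _ _ H2) eps)).
  apply filter_imp; intros s; rewrite CPS_real; exact (fun p => p). }
assert (Hn : filterlim (fun s : R => Cmod (CPS c (RtoC s))) (at_left 1) (locally (Cmod l))).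
{ apply (filterlim_comp _ _ _ (fun s : R => CPS c (RtoC s)) (@norm C_AbsRing C_NormedModule) _ (locally (T := C_NormedModule) l)).
  exact Hlim. apply (filterlim_norm (V := C_NormedModule) l). }
apply (filterlim_le (F := at_left 1) (fun s : R => Cmod (CPS c (RtoC s))) (fun _ => B) (Cmod l) B).
- exists (mkposreal 1 Rlt_0_1); intros s Hs Hs1; apply HB.
  change (Rabs (s - 1) < 1) in Hs; apply Rabs_def2 in Hs; lra.
- exact Hn.
- apply filterlim_const.
Qed.

Lemma CPS_0 (c : nat -> C) : CPS c (RtoC 0) = c O.
Proof.
rewrite CPS_real, !PSeries_0; now destruct (c O).
Qed.

Lemma unit_disc_real s : 0 <= s < 1 -> unit_disc (RtoC s).
Proof. intros Hs; unfold unit_disc; rewrite Cmod_R, Rabs_pos_eq; lra. Qed.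

(** Plays the role of |int_0^1 F'| <= int_0^1 G' without integrating F', where F is the power
    series with coefficients c, whose value at 1 is only reached as a limit. *)
Lemma Cseries_derivative_bound (c : nat -> C) (l : C) (G G' : R -> R) :
  is_Cseries c l -> c O = RtoC 0 ->
  (forall t, 0 <= t <= 1 -> is_derive G t (G' t)) ->
  (forall t, 0 <= t <= 1 -> 0 <= G' t) ->
  (forall t, 0 <= t < 1 -> Cmod (CPS (Cderiv c) (RtoC t)) <= G' t) ->
  Cmod l <= G 1 - G 0.
Proof.
intros H Hc0 HG HG0 Hle.
assert (Hc : conv_disc c) by (apply is_Cseries_conv_disc; now exists l).
apply (Cseries_Abel_bound c l _ H); intros s Hs.
apply (Rle_trans _ (G s - G 0)).
- replace (CPS c (RtoC s)) with (CPS c (RtoC s) - CPS c (RtoC 0))%C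
    by (rewrite CPS_0, Hc0; ring).
  apply (Cmod_mean_value _ (CPS (Cderiv c)) _ G'); [lra| | |]; intros t Ht.
  + apply is_Cderive_CPS; [exact Hc|apply unit_disc_real; lra].
  + apply HG; lra.
  + apply Hle; lra.
- apply Rplus_le_compat_r.
  destruct (MVT_gen G s 1 G') as [x [Hx Ex]].
  { intros t Ht; rewrite Rmin_left, Rmax_right in Ht by lra; apply HG; lra. }
  { intros t Ht; rewrite Rmin_left, Rmax_right in Ht by lra.
    apply derivable_continuous_pt; exists (G' t); apply is_derive_Reals, HG; lra. }
  rewrite Rmin_left, Rmax_right in Hx by lra.
  assert (0 <= G' x * (1 - s)) by (apply Rmult_le_pos; [apply HG0|]; lra).
  lra.
Qed.

(** * The coefficients of the image and its second derivative *)

Lemma CPS_ext (a b : nat -> C) (z : C) : (forall n, a n = b n) -> CPS a z = CPS b z.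
Proof. intros H; unfold CPS, Csum; f_equal; apply Series_ext; intros n; now rewrite H. Qed.

Lemma CPS_unique (a : nat -> C) (z l : C) : is_Cseries (fun n => a n * z ^ n)%C l -> CPS a z = l.
Proof. apply Csum_unique. Qed.

(** The primitive vanishing at 0. *)
Definition prim (a : nat -> C) (j : nat) : C :=
  match j with O => RtoC 0 | S m => (a m / RtoC (INR (S m)))%C end.

Lemma RtoC_INR_S_neq0 n : RtoC (INR (S n)) <> RtoC 0.
Proof. intros H; apply RtoC_inj in H; revert H; apply not_0_INR; lia. Qed.

Lemma Cderiv_prim (a : nat -> C) n : Cderiv (prim a) n = a n.
Proof.
unfold Cderiv; cbn [prim]; field; apply RtoC_INR_S_neq0.
Qed.

(** The coefficients of z^n times the series. *)
Definition shift (n : nat) (a : nat -> C) : nat -> C :=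
  Nat.iter n (fun b j => match j with O => RtoC 0 | S m => b m end) a.

(** Stated with arbitrary weights v, so that it serves both for evaluation (v k = z^k) and for
    integration (v k = 1 / (k + 1)). *)
Lemma is_Cseries_shift (n : nat) (a v : nat -> C) (l : C) :
  is_Cseries (fun k => a k * v (n + k)%nat)%C l ->
  is_Cseries (fun k => shift n a k * v k)%C l.
Proof.
revert v; induction n as [|n IH]; intros v H; [exact H|].
apply (is_series_decr_1 (V := C_NormedModule)).
replace (plus _ _) with l.
- exact (IH (fun k => v (S k)) H).
- simpl; unfold plus, opp; simpl; ring.
Qed.

Lemma is_Cseries_shift_pow (n : nat) (a : nat -> C) (z l : C) :
  is_Cseries (fun k => a k * z ^ k)%C l ->
  is_Cseries (fun k => shift n a k * z ^ k)%C (z ^ n * l)%C.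
Proof.
intros H; apply (is_Cseries_shift n a (fun k => (z ^ k)%C)).
refine (is_series_ext _ _ _ _ (is_series_scal (z ^ n)%C _ _ H)).
intros k; rewrite Cpow_add_r; unfold scal; simpl; unfold mult; simpl; ring.
Qed.

(** Expresses a coefficient of the image as the integral of t^n f(t) over [0,1],
    in the form of the primitive of z^n f evaluated at 1. *)
Lemma is_Cseries_prim_shift (n : nat) (a : nat -> C) (b : C) :
  is_Cseries (fun k => a k / RtoC (INR (n + k + 1)))%C b ->
  is_Cseries (prim (shift n a)) b.
Proof.
intros H; apply (is_series_decr_1 (V := C_NormedModule)).
replace (plus b _) with b.
2:{ simpl; unfold plus, opp; simpl; ring. }
apply (is_Cseries_shift n a (fun k => (/ RtoC (INR (S k)))%C)).
refine (is_series_ext _ _ _ _ H).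
intros k; rewrite Nat.add_1_r; reflexivity.
Qed.

(** The coefficients of the product of the series with the polynomial
    p 0 + p 1 z + ... + p N z^N. *)
Definition polymul (p : nat -> C) (N : nat) (a : nat -> C) (j : nat) : C :=
  Csum_n (fun n => p n * shift n a j)%C N.

Lemma is_Cseries_polymul (p : nat -> C) (N : nat) (a : nat -> C) (z l : C) :
  is_Cseries (fun k => a k * z ^ k)%C l ->
  is_Cseries (fun k => polymul p N a k * z ^ k)%C (Csum_n (fun n => p n * z ^ n)%C N * l)%C.
Proof.
intros H; induction N as [|N IH].
- assert (H0 := is_series_scal (p O) _ _ (is_Cseries_shift_pow 0 a z l H)).
  rewrite sum_O; replace (p O * z ^ 0 * l)%C with (p O * (z ^ 0 * l))%C by ring.
  refine (is_series_ext _ _ _ _ H0).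
  intros k; unfold polymul; rewrite sum_O; unfold scal; simpl; unfold mult; simpl; ring.
- assert (H0 := is_series_scal (p (S N)) _ _ (is_Cseries_shift_pow (S N) a z l H)).
  rewrite sum_Sn.
  replace (plus _ _ * l)%C with
    (plus (Csum_n (fun n => p n * z ^ n) N * l) (p (S N) * (z ^ S N * l)))%C
    by (unfold plus; simpl; ring).
  refine (is_series_ext _ _ _ _ (is_series_plus _ _ _ _ IH H0)).
  intros k; unfold polymul; rewrite sum_Sn; unfold plus, scal; simpl; unfold mult; simpl; ring.
Qed.

Lemma is_Cseries_prim_polymul (p : nat -> C) (N : nat) (a b : nat -> C) :
  (forall n, is_Cseries (prim (shift n a)) (b n)) ->
  is_Cseries (prim (polymul p N a)) (Csum_n (fun n => p n * b n)%C N).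
Proof.
intros H; induction N as [|N IH].
- rewrite sum_O; refine (is_series_ext _ _ _ _ (is_series_scal (p O) _ _ (H O))).
  intros [|k]; unfold polymul, prim, scal; simpl; unfold mult; simpl.
  + ring.
  + rewrite sum_O; unfold Cdiv; simpl; ring.
- rewrite sum_Sn.
  refine (is_series_ext _ _ _ _ (is_series_plus _ _ _ _ IH (is_series_scal (p (S N)) _ _ (H (S N))))).
  intros [|k]; unfold prim.
  + unfold plus, scal; simpl; unfold mult; simpl; ring.
  + unfold polymul; rewrite sum_Sn; unfold plus, scal, Cdiv; simpl; unfold mult; simpl; ring.
Qed.

(** The b n stand for the moments int_0^1 t^n f(t) dt, so their combination with weights p is
    the integral of a polynomial times f, bounded here by the integral of G'. *)
Lemma moment_bound (a b p : nat -> C) (N : nat) (G G' : R -> R) :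
  conv_disc a ->
  (forall n, is_Cseries (prim (shift n a)) (b n)) ->
  (forall t, 0 <= t <= 1 -> is_derive G t (G' t)) ->
  (forall t, 0 <= t <= 1 -> 0 <= G' t) ->
  (forall t, 0 <= t < 1 ->
     Cmod (Csum_n (fun n => p n * RtoC t ^ n)%C N * CPS a (RtoC t)) <= G' t) ->
  Cmod (Csum_n (fun n => p n * b n)%C N) <= G 1 - G 0.
Proof.
intros Ha Hb HG HG0 Hle.
apply (Cseries_derivative_bound (prim (polymul p N a)) _ G G'); auto.
- now apply is_Cseries_prim_polymul.
- intros t Ht; rewrite (CPS_ext _ _ _ (Cderiv_prim _)).
  rewrite (CPS_unique _ _ _ (is_Cseries_polymul p N a (RtoC t) (CPS a (RtoC t))
     (CPS_correct a _ Ha (unit_disc_real t Ht)))).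
  now apply Hle.
Qed.

Lemma conv_disc_shift n (a : nat -> C) : conv_disc a -> conv_disc (shift n a).
Proof.
intros Ha z Hz; destruct (Ha z Hz) as [l Hl]; eexists; apply is_Cseries_shift_pow, Hl.
Qed.

Lemma CPS_shift n (a : nat -> C) z : conv_disc a -> unit_disc z ->
  CPS (shift n a) z = (z ^ n * CPS a z)%C.
Proof. intros Ha Hz; apply CPS_unique, is_Cseries_shift_pow, CPS_correct; assumption. Qed.

Lemma shift_shift n m (a : nat -> C) : shift n (shift m a) = shift (n + m) a.
Proof. unfold shift; now rewrite <- Nat.iter_add. Qed.

Lemma Cmod_moment_le (a b : nat -> C) (M : R) n : conv_disc a ->
  (forall n, is_Cseries (prim (shift n a)) (b n)) ->
  (forall t, 0 <= t < 1 -> Cmod (CPS a (RtoC t)) <= M) ->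
  Cmod (b n) <= M / INR (S n).
Proof.
intros Ha Hb HM.
assert (HM0 : 0 <= M).
{ apply (Rle_trans _ _ _ (Cmod_ge_0 (CPS a (RtoC 0)))), HM; lra. }
assert (Hn : 0 < INR (S n)) by (apply lt_0_INR; lia).
set (p := fun _ : nat => RtoC 1).
replace (b n) with (Csum_n (fun k => p k * b (k + n)%nat)%C 0)
  by (rewrite sum_O; unfold p; simpl; ring).
set (G := fun t => M / INR (S n) * t ^ S n).
replace (M / INR (S n)) with (G 1 - G 0) by (unfold G; rewrite pow1, pow_i by lia; ring).
apply (moment_bound (shift n a) _ p 0 G (fun t => M * t ^ n)).
- now apply conv_disc_shift.
- intros k; rewrite shift_shift; apply Hb.
- intros t _; unfold G; auto_derive; [trivial|].
  change (match n with O => 1 | S _ => INR n + 1 end) with (INR (S n)); field; lra.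
- intros t Ht; apply Rmult_le_pos; [exact HM0|apply pow_le; lra].
- intros t Ht; rewrite CPS_shift by (auto using unit_disc_real).
  rewrite sum_O, !Cmod_mult, !Cmod_pow, Cmod_R, (Rabs_pos_eq t) by lra.
  unfold p; rewrite Cmod_1; simpl.
  rewrite !Rmult_1_l, Rmult_comm; apply Rmult_le_compat_r; [apply pow_le; lra|now apply HM].
Qed.

(** The truncation of 2 / (1 - w)^3 = sum (n+1) (n+2) w^n with its exact remainder. Clearing
    the denominator gives a truncation error proportional to 1 / |1 - w|^3, with a factor
    uniform on compact subsets of the disc. *)
Lemma sum_cubic_closed_form (w : C) N :
  (Csum_n (fun n => RtoC (INR (S n) * INR (S (S n))) * w ^ n)%C N * (1 - w) ^ 3 =
   2 - w ^ S N * (RtoC (INR (S (S N)) * INR (S (S (S N))))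
                  - 2 * RtoC (INR (S N) * INR (S (S (S N)))) * w
                  + RtoC (INR (S N) * INR (S (S N))) * w ^ 2))%C.
Proof.
induction N as [|N IH].
- rewrite sum_O; simpl INR; rewrite ?RtoC_mult, ?RtoC_plus; simpl; ring.
- rewrite sum_Sn; unfold plus; simpl (AbelianMonoid.plus _ _).
  rewrite Cmult_plus_distr_r, IH.
  rewrite !(S_INR (S _)), !(S_INR N), !RtoC_mult, !RtoC_plus; simpl; ring.
Qed.

(** The integral of 2 t / |1 - t z|^3 over [0,1] in closed form. *)
Definition kernel (z : C) : R := 2 / (Cmod (1 - z) * (Cmod (1 - z) + 1 - Re z)).

(** Here |1 - t z|^2 = (1 - x t)^2 + (y t)^2 for z = x + i y. Points of the real axis are
    excluded because this primitive degenerates there; a circle meets it twice only. *)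
Lemma is_derive_kernel_primitive (x y t : R) : y <> 0 ->
  is_derive (fun t => (x * t - 1) / (y ^ 2 * sqrt ((1 - x * t) ^ 2 + (y * t) ^ 2))) t
    (t / sqrt ((1 - x * t) ^ 2 + (y * t) ^ 2) ^ 3).
Proof.
intros Hy.
assert (Hy2 : 0 < y ^ 2) by (apply pow2_gt_0; exact Hy).
assert (HD : 0 < (1 - x * t) ^ 2 + (y * t) ^ 2).
{ destruct (Req_dec t 0) as [->|Ht].
  - rewrite !Rmult_0_r; lra.
  - assert (0 < (y * t) ^ 2) by (apply pow2_gt_0, Rmult_integral_contrapositive; split; assumption).
    generalize (pow2_ge_0 (1 - x * t)); lra. }
auto_derive.
- split; [exact HD|split; [|trivial]].
  apply Rmult_integral_contrapositive; split; [lra|].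
  apply Rgt_not_eq, sqrt_lt_R0; exact HD.
- replace ((1 + - (x * t)) * ((1 + - (x * t)) * 1) + y * t * (y * t * 1))
    with ((1 - x * t) ^ 2 + (y * t) ^ 2) by ring.
  assert (Hs := sqrt_sqrt _ (Rlt_le _ _ HD)).
  assert (Hs0 := sqrt_lt_R0 _ HD).
  set (s := sqrt _) in *.
  assert (E : t * y ^ 2 = x * (s * s) - (x * t - 1) * (y ^ 2 * t - x * (1 - x * t))) by (rewrite Hs; ring).
  transitivity ((t * y ^ 2) / (y ^ 2 * s ^ 3)).
  + rewrite E; field; lra.
  + field; lra.
Qed.

Lemma Cmod_1_minus_real_mult (x y t : R) :
  Cmod (1 - RtoC t * (x, y)) = sqrt ((1 - x * t) ^ 2 + (y * t) ^ 2).
Proof. unfold Cmod; f_equal; simpl; ring. Qed.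

Lemma kernel_integral (x y : R) : y <> 0 ->
  (x * 1 - 1) / (y ^ 2 * sqrt ((1 - x * 1) ^ 2 + (y * 1) ^ 2))
   - (x * 0 - 1) / (y ^ 2 * sqrt ((1 - x * 0) ^ 2 + (y * 0) ^ 2))
  = kernel (x, y) / 2.
Proof.
intros Hy.
assert (Hy2 : 0 < y ^ 2) by (apply pow2_gt_0; exact Hy).
unfold kernel.
assert (Ed : Cmod (1 - (x, y)) = sqrt ((1 - x * 1) ^ 2 + (y * 1) ^ 2)).
{ rewrite <- Cmod_1_minus_real_mult; f_equal; ring. }
rewrite Ed.
replace ((1 - x * 0) ^ 2 + (y * 0) ^ 2) with 1 by ring; rewrite sqrt_1.
assert (HD : 0 < (1 - x * 1) ^ 2 + (y * 1) ^ 2) by (generalize (pow2_ge_0 (1 - x * 1)); lra).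
assert (Hs := sqrt_sqrt _ (Rlt_le _ _ HD)).
assert (Hs0 := sqrt_lt_R0 _ HD).
set (d := sqrt _) in *.
assert (Hdx : 0 < d + 1 - x) by nra.
change (Re (x, y)) with x.
assert (E : y ^ 2 = (d - (1 - x)) * (d + 1 - x)) by nra.
rewrite E in *; field; split; nra.
Qed.

Lemma Cmod_1_minus_pos (z : C) : unit_disc z -> 0 < Cmod (1 - z).
Proof.
intros Hz; apply Cmod_gt_0; intros E; unfold unit_disc in Hz.
replace z with (1 - (1 - z))%C in Hz by ring.
rewrite E in Hz; unfold Cminus in Hz; rewrite Copp_0, Cplus_0_r, Cmod_1 in Hz; lra.
Qed.

Lemma Cmod_sum_cubic_le (w : C) (r : R) N : Cmod w <= r < 1 ->
  Cmod (Csum_n (fun n => RtoC (INR (S n) * INR (S (S n))) * w ^ n)%C N) <=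
  (2 + 4 * (INR (S (S N)) * INR (S (S (S N))) * r ^ S N)) / Cmod (1 - w) ^ 3.
Proof.
intros Hw.
assert (Hd : 0 < Cmod (1 - w)) by (apply Cmod_1_minus_pos; unfold unit_disc; lra).
assert (Hd3 : 0 < Cmod (1 - w) ^ 3) by (now apply pow_lt).
apply (Rmult_le_reg_r (Cmod (1 - w) ^ 3) _ _ Hd3).
rewrite <- Cmod_pow at 1; rewrite <- Cmod_mult, sum_cubic_closed_form.
replace (_ / _ * _) with (2 + 4 * (INR (S (S N)) * INR (S (S (S N))) * r ^ S N)) by (field; lra).
apply (Rle_trans _ _ _ (Cmod_triangle _ _)); rewrite Cmod_opp.
apply Rplus_le_compat.
{ rewrite Cmod_R, Rabs_pos_eq; lra. }
rewrite Cmod_mult, Cmod_pow.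
replace (4 * _) with (r ^ S N * (4 * (INR (S (S N)) * INR (S (S (S N)))))) by ring.
generalize (Cmod_ge_0 w); intros Hw0.
apply Rmult_le_compat; [now apply pow_le|apply Cmod_ge_0|apply pow_incr; lra|].
apply (Rle_trans _ _ _ (Cmod_triangle _ _)).
apply (Rle_trans _ (Cmod (RtoC (INR (S (S N)) * INR (S (S (S N)))))
   + Cmod (2 * RtoC (INR (S N) * INR (S (S (S N)))) * w)
   + Cmod (RtoC (INR (S N) * INR (S (S N))) * w ^ 2))).
{ apply Rplus_le_compat_r; apply (Rle_trans _ _ _ (Cmod_triangle _ _)); rewrite Cmod_opp; lra. }
assert (HP : forall i j, 0 <= INR i * INR j) by (intros; apply Rmult_le_pos; apply pos_INR).
rewrite !Cmod_mult, Cmod_pow, !Cmod_R.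
rewrite !(Rabs_pos_eq (INR _ * INR _)) by apply HP.
rewrite (Rabs_pos_eq 2) by lra.
assert (H2 : Cmod w ^ 2 <= 1) by (simpl; nra).
apply (Rle_trans _ (INR (S (S N)) * INR (S (S (S N))) + 2 * (INR (S N) * INR (S (S (S N)))) * 1
  + INR (S N) * INR (S (S N)) * 1)).
- apply Rplus_le_compat; [apply Rplus_le_compat_l|]; apply Rmult_le_compat_l; try lra.
  + generalize (HP (S N) (S (S (S N)))); lra.
  + apply HP.
- rewrite !(S_INR (S _)), !(S_INR N); generalize (pos_INR N); intros; nra.
Qed.

Lemma quadratic_geometric_lim_0 (r : R) : 0 <= r < 1 ->
  is_lim_seq (fun N => INR (S (S N)) * INR (S (S (S N))) * r ^ S N) 0.
Proof.
intros Hr.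
apply (is_lim_seq_incr_1 (fun N => INR (S N) * INR (S (S N)) * r ^ N)).
apply ex_series_lim_0.
apply (ex_series_ext (fun n => PS_derive (PS_derive (fun k => Cmod 1)) n * r ^ n)).
{ intros n; unfold PS_derive; rewrite Cmod_1.
  change (INR (S n) * (INR (S (S n)) * 1) * r ^ n = INR (S n) * INR (S (S n)) * r ^ n); ring. }
apply radius_ex_series; [|exact Hr].
rewrite !CV_radius_derive.
apply (conv_disc_radius (fun _ => RtoC 1)).
apply (bounded_conv_disc _ 1); intros n; rewrite Cmod_1; lra.
Qed.

(** Each partial sum of g''(z) is a combination of the moments of t^2 f(t), with weights p
    for which p 0 + ... + p N t^N truncates 2 / (1 - t z)^3. The truncation error enters as a factor
    (2 + tau N) / 2 that tends to 1. *)
Lemma Cmod_second_derivative_le (a b : nat -> C) (M : R) (z l : C) : conv_disc a ->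
  (forall n, is_Cseries (prim (shift n a)) (b n)) ->
  (forall t, 0 <= t < 1 -> Cmod (CPS a (RtoC t)) <= M) ->
  unit_disc z -> Im z <> 0 ->
  is_Cseries (fun n => RtoC (INR (S n) * INR (S (S n))) * b (S (S n)) * z ^ n)%C l ->
  Cmod l <= M * kernel z.
Proof.
intros Ha Hb HM Hz Hy Hl.
assert (HM0 : 0 <= M).
{ apply (Rle_trans _ _ _ (Cmod_ge_0 (CPS a (RtoC 0)))), HM; lra. }
destruct z as [x y]; change (Im (x, y)) with y in Hy.
set (tau := fun N => 4 * (INR (S (S N)) * INR (S (S (S N))) * Cmod (x, y) ^ S N)).
assert (Htau : is_lim_seq tau 0).
{ replace (Finite 0) with (Rbar_mult 4 0) by (simpl; f_equal; ring).
  apply is_lim_seq_scal_l, quadratic_geometric_lim_0; split; [apply Cmod_ge_0|exact Hz]. }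
assert (Htau0 : forall N, 0 <= tau N).
{ intros N; unfold tau; apply Rmult_le_pos; [lra|apply Rmult_le_pos].
  - apply Rmult_le_pos; apply pos_INR.
  - apply pow_le, Cmod_ge_0. }
apply (is_lim_seq_le _ (fun N => M * (2 + tau N) * (kernel (x, y) / 2)) (Cmod l) (M * kernel (x, y)))
  with (2 := is_lim_seq_Cmod _ _ Hl).
2:{ replace (Finite (M * kernel (x, y))) with (Finite (M * (2 + 0) * (kernel (x, y) / 2)))
      by (f_equal; field).
    apply is_lim_seq_mult'; [|apply is_lim_seq_const].
    apply is_lim_seq_mult'; [apply is_lim_seq_const|].
    apply is_lim_seq_plus'; [apply is_lim_seq_const|exact Htau]. }
intros N.
rewrite <- (kernel_integral x y Hy).
rewrite Rmult_minus_distr_l.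
set (F := fun t => M * (2 + tau N) * ((x * t - 1) / (y ^ 2 * sqrt ((1 - x * t) ^ 2 + (y * t) ^ 2)))).
change (Cmod (Csum_n (fun n => RtoC (INR (S n) * INR (S (S n))) * b (S (S n)) * (x, y) ^ n)%C N) <= F 1 - F 0).
set (p := fun n => (RtoC (INR (S n) * INR (S (S n))) * (x, y) ^ n)%C).
rewrite (sum_n_ext _ (fun n => (p n * b (n + 2)%nat)%C)).
2:{ intros n; unfold p; rewrite Nat.add_comm; rewrite <- !Cmult_assoc, (Cmult_comm (b _)); reflexivity. }
assert (HMt : 0 <= M * (2 + tau N)) by (apply Rmult_le_pos; [|specialize (Htau0 N)]; lra).
apply (moment_bound (shift 2 a) _ p N F
  (fun t => M * (2 + tau N) * (t / sqrt ((1 - x * t) ^ 2 + (y * t) ^ 2) ^ 3))).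
- now apply conv_disc_shift.
- intros k; rewrite shift_shift; apply Hb.
- intros t _; apply (is_derive_scal (fun t => (x * t - 1) / _)), is_derive_kernel_primitive, Hy.
- intros t Ht; apply Rmult_le_pos; [exact HMt|].
  apply Rdiv_le_0_compat; [lra|]; apply pow_lt.
  rewrite <- Cmod_1_minus_real_mult; apply Cmod_1_minus_pos.
  unfold unit_disc in *; rewrite Cmod_mult, Cmod_R, Rabs_pos_eq by lra.
  generalize (Cmod_ge_0 (x, y)); nra.
- intros t Ht; rewrite CPS_shift by (auto using unit_disc_real).
  assert (Hw : Cmod (RtoC t * (x, y)) <= Cmod (x, y) < 1).
  { split; [|exact Hz]; rewrite Cmod_mult, Cmod_R, Rabs_pos_eq by lra.
    generalize (Cmod_ge_0 (x, y)); nra. }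
  rewrite (sum_n_ext _ (fun n => RtoC (INR (S n) * INR (S (S n))) * (RtoC t * (x, y)) ^ n)%C).
  2:{ intros n; unfold p; rewrite Cpow_mult_l, (Cmult_comm (RtoC t ^ n)); symmetry; apply Cmult_assoc. }
  rewrite !Cmod_mult, Cmod_pow, Cmod_R, (Rabs_pos_eq t) by lra.
  rewrite <- Cmod_1_minus_real_mult.
  assert (HS := Cmod_sum_cubic_le _ _ N Hw).
  fold (tau N) in HS.
  assert (Hd : 0 < Cmod (1 - RtoC t * (x, y))) by (apply Cmod_1_minus_pos; unfold unit_disc; lra).
  assert (Hd3 := pow_lt _ 3 Hd).
  replace (M * (2 + tau N) * (t / Cmod (1 - RtoC t * (x, y)) ^ 3))
    with ((2 + tau N) / Cmod (1 - RtoC t * (x, y)) ^ 3 * (t * M)) by (field; lra).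
  apply Rmult_le_compat; [apply Cmod_ge_0| |exact HS|].
  + apply Rmult_le_pos; [apply pow2_ge_0|apply Cmod_ge_0].
  + apply Rmult_le_compat; [apply pow2_ge_0|apply Cmod_ge_0|simpl; nra|now apply HM].
Qed.

(** * The mean of the kernel over a circle *)

(** The distance from 1 to r e^(i th), in terms of the half angle. *)
Definition chord (r th : R) : R :=
  sqrt ((1 - r) ^ 2 * cos (th / 2) ^ 2 + (1 + r) ^ 2 * sin (th / 2) ^ 2).

Lemma cos_half th : cos th = cos (th / 2) ^ 2 - sin (th / 2) ^ 2.
Proof. replace th with (2 * (th / 2)) at 1 by field; rewrite cos_2a; ring. Qed.

Lemma sin_half th : sin th = 2 * sin (th / 2) * cos (th / 2).
Proof. replace th with (2 * (th / 2)) at 1 by field; apply sin_2a. Qed.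

Lemma cos2_sin2 x : cos x ^ 2 + sin x ^ 2 = 1.
Proof. generalize (sin2_cos2 x); unfold Rsqr; lra. Qed.

Lemma chord_Cmod (r th : R) : Cmod (1 - (r * cos th, r * sin th)) = chord r th.
Proof.
unfold Cmod, chord; f_equal; simpl fst; simpl snd.
rewrite (cos_half th), (sin_half th); generalize (cos2_sin2 (th / 2)).
set (c := cos _); set (s := sin _); intros E.
assert (Es : s ^ 2 = 1 - c ^ 2) by lra.
replace ((1 + - (r * (c ^ 2 - s ^ 2))) ^ 2 + (0 + - (r * (2 * s * c))) ^ 2)
  with (1 - 2 * r * (c ^ 2 - s ^ 2) + r ^ 2 * (c ^ 2 + s ^ 2) ^ 2) by ring.
rewrite Es; ring.
Qed.

Lemma chord_radicand_pos (r th : R) : 0 < r < 1 ->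
  0 < (1 - r) ^ 2 * cos (th / 2) ^ 2 + (1 + r) ^ 2 * sin (th / 2) ^ 2.
Proof.
intros Hr; generalize (cos2_sin2 (th / 2)) (pow2_ge_0 (cos (th / 2))) (pow2_ge_0 (sin (th / 2))).
set (c := cos _ ^ 2); set (s := sin _ ^ 2); intros; nra.
Qed.

Lemma chord_pos (r th : R) : 0 < r < 1 -> 0 < chord r th.
Proof. intros Hr; now apply sqrt_lt_R0, chord_radicand_pos. Qed.

Lemma cos_half_ge_0 th : 0 <= th <= PI -> 0 <= cos (th / 2).
Proof. intros H; apply cos_ge_0; generalize PI_RGT_0; lra. Qed.

(** 1 - Re z >= 1 - r >= (1 - r) cos (th/2). Little is lost near th = 0, where the kernel
    concentrates as r tends to 1. *)
Lemma kernel_circle_le (r th : R) : 0 < r < 1 -> 0 <= th <= PI ->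
  kernel (r * cos th, r * sin th) <=
  2 / (chord r th * (chord r th + (1 - r) * cos (th / 2))).
Proof.
intros Hr Hth; unfold kernel; rewrite chord_Cmod.
change (Re (r * cos th, r * sin th)) with (r * cos th).
assert (Hd := chord_pos r th Hr); assert (Hc := cos_half_ge_0 th Hth).
generalize (COS_bound (th / 2)) (COS_bound th); intros H1 H2.
apply Rmult_le_compat_l; [lra|]; apply Rinv_le_contravar.
- apply Rmult_lt_0_compat; [exact Hd|nra].
- apply Rmult_le_compat_l; [lra|nra].
Qed.

(** This primitive is 4 / (1 - r^2) * tan (phi / 4), where
    e^(i phi) = (e^(i th) - r) / (1 - r e^(i th)) is the image of e^(i th) under the
    automorphism of the disc that sends r to 0. *)
Lemma is_derive_circle_primitive (r th : R) : 0 < r < 1 -> 0 <= th <= PI ->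
  is_derive (fun th => 4 / (1 - r) * (sin (th / 2) / ((1 - r) * cos (th / 2) + chord r th))) th
   (2 / (chord r th * (chord r th + (1 - r) * cos (th / 2)))).
Proof.
intros Hr Hth.
assert (HD := chord_radicand_pos r th Hr).
assert (Hd := chord_pos r th Hr); assert (Hc := cos_half_ge_0 th Hth).
assert (Hs := sqrt_sqrt _ (Rlt_le _ _ HD)).
assert (E := cos2_sin2 (th / 2)).
assert (Hden : 0 < (1 - r) * cos (th / 2) + chord r th).
{ assert (0 <= (1 - r) * cos (th / 2)) by (apply Rmult_le_pos; lra); lra. }
unfold chord in *.
auto_derive.
- unfold Rdiv in *; simpl in *; repeat split; try exact HD; lra.
- unfold Rdiv in *; simpl in *.
  set (d := sqrt _) in *; set (c := cos _) in *; set (s := sin _) in *.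
  assert (Es : s * s = 1 - c * c) by lra.
  transitivity (2 * (c * (d * ((1 - r) * c + d)) + s * ((1 - r) * s * d - ((1 + r) ^ 2 - (1 - r) ^ 2) * s * c))
     / ((1 - r) * d * ((1 - r) * c + d) ^ 2)).
  + field; lra.
  + assert (E2 : c * (d * ((1 - r) * c + d)) + s * ((1 - r) * s * d - ((1 + r) ^ 2 - (1 - r) ^ 2) * s * c)
       = (1 - r) * (d + (1 - r) * c)).
    { replace (c * (d * ((1 - r) * c + d)) + s * ((1 - r) * s * d - ((1 + r) ^ 2 - (1 - r) ^ 2) * s * c))
       with (c * (d * d) + (1 - r) * d * (c * c + s * s) - ((1 + r) ^ 2 - (1 - r) ^ 2) * c * (s * s)) by ring.
      assert (Hs' : d * d = (1 - r) ^ 2 * (c * c) + (1 + r) ^ 2 * (s * s)) by (rewrite Hs; ring).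
      rewrite Hs', Es; ring. }
    rewrite E2; field; lra.
Qed.

Lemma continuous_circle_bound (r th : R) : 0 < r < 1 -> 0 <= th <= PI ->
  continuous (fun th => 2 / (chord r th * (chord r th + (1 - r) * cos (th / 2)))) th.
Proof.
intros Hr Hth.
assert (HD := chord_radicand_pos r th Hr).
assert (Hd := chord_pos r th Hr); assert (Hc := cos_half_ge_0 th Hth).
assert (0 <= (1 - r) * cos (th / 2)) by (apply Rmult_le_pos; lra).
apply (ex_derive_continuous (V := R_NormedModule)).
unfold chord in *; auto_derive.
unfold Rdiv in *; simpl in *; repeat split; try exact HD.
apply Rmult_integral_contrapositive; split; lra.
Qed.

Lemma is_RInt_circle_bound (r : R) : 0 < r < 1 ->
  is_RInt (fun th => 2 / (chord r th * (chord r th + (1 - r) * cos (th / 2)))) 0 PI (4 / (1 - r ^ 2)).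
Proof.
intros Hr; assert (HPI := PI_RGT_0).
set (G := fun th => 4 / (1 - r) * (sin (th / 2) / ((1 - r) * cos (th / 2) + chord r th))).
replace (4 / (1 - r ^ 2)) with (minus (G PI) (G 0)).
- apply (is_RInt_derive G); rewrite Rmin_left, Rmax_right by lra; intros x Hx.
  + now apply is_derive_circle_primitive.
  + now apply continuous_circle_bound.
- unfold G, chord, minus, plus, opp; simpl.
  rewrite sin_PI2, cos_PI2, Rdiv_0_l, sin_0, cos_0.
  replace ((1 - r) * ((1 - r) * 1) * (0 * (0 * 1)) + (1 + r) * ((1 + r) * 1) * (1 * (1 * 1))) with ((1 + r) ^ 2) by ring.
  rewrite <- (Rsqr_pow2 (1 + r)), sqrt_Rsqr by lra.
  replace ((1 - r) * ((1 - r) * 1) * (1 * (1 * 1)) + (1 + r) * ((1 + r) * 1) * (0 * (0 * 1))) with ((1 - r) ^ 2) by ring.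
  rewrite <- (Rsqr_pow2 (1 - r)), sqrt_Rsqr by lra.
  field; nra.
Qed.

Lemma RInt_half_circle_le (h : R -> R) (A r : R) : 0 < r < 1 ->
  ex_RInt h 0 PI -> 0 <= A ->
  (forall th, 0 < th < PI -> h th <= A * kernel (r * cos th, r * sin th)) ->
  RInt h 0 PI <= A * (4 / (1 - r ^ 2)).
Proof.
intros Hr Hex HA Hh; assert (HPI := PI_RGT_0).
assert (HI := is_RInt_scal _ _ _ A _ (is_RInt_circle_bound r Hr)).
apply Rle_trans with (2 := Req_le _ _ (is_RInt_unique _ _ _ _ HI)).
apply RInt_le; [lra|exact Hex|eexists; exact HI|].
intros th Hth; apply (Rle_trans _ _ _ (Hh th Hth)).
apply Rmult_le_compat_l; [exact HA|]; apply kernel_circle_le; lra.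
Qed.

(** The lower half circle is reflected onto the upper one, the kernel being symmetric. *)
Lemma RInt_circle_le (h : R -> R) (A r : R) : 0 < r < 1 -> 0 <= A ->
  (forall th : R, continuous h th) ->
  (forall th, sin th <> 0 -> h th <= A * kernel (r * cos th, r * sin th)) ->
  RInt h 0 (2 * PI) <= A * (8 / (1 - r ^ 2)).
Proof.
intros Hr HA Hcont Hh; assert (HPI := PI_RGT_0).
assert (Hex : forall a b, ex_RInt h a b) by (intros; apply (ex_RInt_continuous (V := R_CompleteNormedModule)); auto).
rewrite <- (RInt_Chasles h 0 PI (2 * PI)) by apply Hex.
assert (H1 : RInt h 0 PI <= A * (4 / (1 - r ^ 2))).
{ apply RInt_half_circle_le; auto; intros th Hth; apply Hh.
  apply Rgt_not_eq, sin_gt_0; lra. }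
assert (H2 : RInt h PI (2 * PI) <= A * (4 / (1 - r ^ 2))).
{ assert (Hex2 : ex_RInt (fun th => h (-1 * th + 2 * PI)) 0 PI).
  { apply (ex_RInt_continuous (V := R_CompleteNormedModule)); intros th _.
    apply (continuous_comp (fun th => -1 * th + 2 * PI) h); [|apply Hcont].
    apply (ex_derive_continuous (V := R_NormedModule)); auto_derive; trivial. }
  replace (RInt h PI (2 * PI)) with (RInt (fun th => h (-1 * th + 2 * PI)) 0 PI).
  - apply RInt_half_circle_le; auto; intros th Hth.
    replace (cos th) with (cos (-1 * th + 2 * PI)).
    2:{ replace (-1 * th + 2 * PI) with (- th + 2 * INR 1 * PI) by (simpl; ring).
        now rewrite cos_period, cos_neg. }
    assert (Es : sin (-1 * th + 2 * PI) = - sin th).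
    { replace (-1 * th + 2 * PI) with (- th + 2 * INR 1 * PI) by (simpl; ring).
      now rewrite sin_period, sin_neg. }
    assert (Hs : 0 < sin th) by (apply sin_gt_0; lra).
    replace (kernel (r * cos (-1 * th + 2 * PI), r * sin th))
      with (kernel (r * cos (-1 * th + 2 * PI), r * sin (-1 * th + 2 * PI))).
    + apply Hh; lra.
    + rewrite Es; unfold kernel, Cmod; simpl.
      repeat (f_equal; try ring).
  - assert (E := RInt_comp_lin h (-1) (2 * PI) 0 PI).
    replace (-1 * 0 + 2 * PI) with (2 * PI) in E by ring.
    replace (-1 * PI + 2 * PI) with PI in E by ring.
    specialize (E (Hex _ _)).
    rewrite (RInt_scal (fun y => h (-1 * y + 2 * PI)) 0 PI (-1) Hex2) in E.
    rewrite <- (opp_RInt_swap h) in E by apply Hex.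
    unfold scal, opp in E; simpl in E; unfold mult in E; simpl in E; lra. }
apply (Rle_trans _ (A * (4 / (1 - r ^ 2)) + A * (4 / (1 - r ^ 2)))).
- apply Rplus_le_compat; assumption.
- right; field; nra.
Qed.

(** * The upper bound *)

Lemma power_series_conv_disc (a : nat -> C) (f : C -> C) : power_series_on_disc a f -> conv_disc a.
Proof. intros H z Hz; exists (f z); apply is_pseries_Cseries, H, Hz. Qed.

Lemma power_series_CPS (a : nat -> C) (f : C -> C) z :
  power_series_on_disc a f -> unit_disc z -> f z = CPS a z.
Proof. intros H Hz; symmetry; apply CPS_unique, is_pseries_Cseries, H, Hz. Qed.

Lemma CPS_power_series (a : nat -> C) : conv_disc a -> power_series_on_disc a (CPS a).
Proof. intros Ha z Hz; apply is_pseries_Cseries; now apply CPS_correct. Qed.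

Lemma analytic_CPS (a : nat -> C) : conv_disc a -> analytic_on_disc (CPS a).
Proof. intros Ha z Hz; eexists; now apply is_Cderive_CPS. Qed.

Lemma C_derive_CPS (f : C -> C) (a : nat -> C) z : conv_disc a ->
  (forall w, unit_disc w -> f w = CPS a w) -> unit_disc z ->
  C_derive f z = CPS (Cderiv a) z.
Proof.
intros Ha Hf Hz; apply is_C_derive_unique.
apply (is_derive_ext_loc (CPS a)); [|now apply is_Cderive_CPS].
unfold unit_disc in Hz.
assert (Hd : 0 < 1 - Cmod z) by lra.
exists (mkposreal _ Hd); intros w Hw; symmetry; apply Hf.
change (Cmod (w - z) < 1 - Cmod z) in Hw; unfold unit_disc.
replace w with (z + (w - z))%C by ring.
generalize (Cmod_triangle z (w - z)); lra.
Qed.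

Lemma Cmod_circle (r t : R) : 0 <= r -> Cmod (r * cos t, r * sin t) = r.
Proof.
intros Hr; unfold Cmod; simpl fst; simpl snd.
replace ((r * cos t) ^ 2 + (r * sin t) ^ 2) with (Rsqr r * (cos t ^ 2 + sin t ^ 2))
  by (unfold Rsqr; ring).
rewrite cos2_sin2, Rmult_1_r; now apply sqrt_Rsqr.
Qed.

Lemma unit_disc_circle (r t : R) : 0 <= r < 1 -> unit_disc (r * cos t, r * sin t).
Proof. intros Hr; unfold unit_disc; rewrite Cmod_circle; lra. Qed.

Lemma continuous_Cmod_CPS_circle (a : nat -> C) (r t : R) : conv_disc a -> 0 <= r < 1 ->
  continuous (fun t : R => Cmod (CPS a (r * cos t, r * sin t))) t.
Proof.
intros Ha Hr.
assert (H1 : continuous (U := C_UniformSpace) (fun t : R => (r * cos t, r * sin t)) t).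
{ apply (filterlim_locally (U := C_UniformSpace)); intros eps.
  assert (Hc : continuous (fun t => r * cos t) t).
  { apply (ex_derive_continuous (V := R_NormedModule)); auto_derive; trivial. }
  assert (Hs : continuous (fun t => r * sin t) t).
  { apply (ex_derive_continuous (V := R_NormedModule)); auto_derive; trivial. }
  exact (filter_and _ _ (proj1 (filterlim_locally _ _) Hc eps) (proj1 (filterlim_locally _ _) Hs eps)). }
set (z := (r * cos t, r * sin t)).
assert (H2 : filterlim (CPS a) (locally (T := C_UniformSpace) z) (locally (T := C_UniformSpace) (CPS a z))).
{ assert (H := ex_derive_continuous (CPS a) z (analytic_CPS a Ha z (unit_disc_circle r t Hr))).
  intros P HP; apply locally_C; exact (H P HP). }
assert (H3 := filterlim_norm (V := C_NormedModule) (CPS a z)).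
exact (filterlim_comp _ _ _ _ _ _ _ _ (filterlim_comp _ _ _ _ _ _ _ _ H1 H2) H3).
Qed.

Lemma hilbert_coefficients_shift (a b : nat -> C) :
  (forall n, is_Cseries (fun k => a k / RtoC (INR (n + k + 1)))%C (b n)) ->
  forall n, is_Cseries (prim (shift n a)) (b n).
Proof. intros H n; apply is_Cseries_prim_shift, H. Qed.

(** Stated for every M, since M = 1 bounds the operator norm while a general M shows that the
    image of every bounded function lies in the Zygmund space. *)
Lemma Zygmund_norm_hilbert_le (f g : C -> C) (M : R) : is_hilbert f g ->
  (forall z, unit_disc z -> Cmod (f z) <= M) ->
  Rbar_le (Zygmund_norm g) (M * (3 / 2 + 4 / PI)).
Proof.
intros [_ [_ [a [b [Hf [Hb Hg]]]]]] HM.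
assert (Ha := power_series_conv_disc _ _ Hf).
assert (Hcb := power_series_conv_disc _ _ Hg).
assert (Hb' := hilbert_coefficients_shift a b Hb).
assert (HM' : forall t, 0 <= t < 1 -> Cmod (CPS a (RtoC t)) <= M).
{ intros t Ht; rewrite <- (power_series_CPS a f); auto using unit_disc_real. }
assert (HM0 : 0 <= M).
{ apply (Rle_trans _ _ _ (Cmod_ge_0 (CPS a (RtoC 0)))), HM'; lra. }
assert (Hgb : forall w, unit_disc w -> g w = CPS b w) by (intros; now apply power_series_CPS).
assert (Hg1 : forall w, unit_disc w -> C_derive g w = CPS (Cderiv b) w)
  by (intros; now apply C_derive_CPS).
assert (Hcb1 := conv_disc_Cderiv b Hcb).
assert (Hg2 : forall w, unit_disc w -> C_derive (C_derive g) w = CPS (Cderiv (Cderiv b)) w)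
  by (intros; now apply C_derive_CPS).
assert (Hcb2 := conv_disc_Cderiv _ Hcb1).
assert (HPI := PI_RGT_0).
assert (H0 : unit_disc (RtoC 0)) by (apply unit_disc_real; lra).
unfold Zygmund_norm.
replace (M * (3 / 2 + 4 / PI)) with ((M + M / 2) + M * (4 / PI)) by (field; lra).
change (Finite (M + M / 2 + M * (4 / PI))) with (Rbar_plus (M + M / 2) (M * (4 / PI))).
apply Rbar_plus_le_compat.
- rewrite Hgb, Hg1, !CPS_0 by exact H0; simpl; apply Rplus_le_compat.
  + generalize (Cmod_moment_le a b M 0 Ha Hb' HM'); simpl; lra.
  + generalize (Cmod_moment_le a b M 1 Ha Hb' HM'); unfold Cderiv; simpl INR.
    rewrite Cmult_1_l; intros; lra.
- apply Lub_Rbar_correct; intros x [r [Hr ->]]; simpl.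
  unfold M1.
  rewrite (RInt_ext _ (fun t => Cmod (CPS (Cderiv (Cderiv b)) (r * cos t, r * sin t)))).
  2:{ intros t _; rewrite Hg2; [reflexivity|apply unit_disc_circle; lra]. }
  assert (HI : RInt (fun t => Cmod (CPS (Cderiv (Cderiv b)) (r * cos t, r * sin t))) 0 (2 * PI)
    <= M * (8 / (1 - r ^ 2))).
  { apply RInt_circle_le; [exact Hr|exact HM0| |].
    - intros t; apply continuous_Cmod_CPS_circle; [exact Hcb2|lra].
    - intros t Ht.
      assert (Hz : unit_disc (r * cos t, r * sin t)) by (apply unit_disc_circle; lra).
      apply (Cmod_second_derivative_le a b); auto.
      + simpl; apply Rmult_integral_contrapositive; split; [lra|exact Ht].
      + refine (is_series_ext _ _ _ _ (CPS_correct _ _ Hcb2 Hz)).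
        intros n; unfold Cderiv; rewrite RtoC_mult.
        rewrite (Cmult_assoc (INR (S n))); reflexivity. }
  assert (Hr2 : 0 < 1 - r ^ 2) by nra.
  apply (Rle_trans _ ((1 - r ^ 2) * (/ (2 * PI) * (M * (8 / (1 - r ^ 2)))))).
  + apply Rmult_le_compat_l; [lra|]; apply Rmult_le_compat_l; [|exact HI].
    left; apply Rinv_0_lt_compat; lra.
  + right; field; lra.
Qed.

(** * Bessel's inequality and the existence of the image *)

Lemma sum_n_incr (v : nat -> R) n m : (forall k, 0 <= v k) -> (n <= m)%nat -> sum_n v n <= sum_n v m.
Proof.
intros Hv Hnm; induction Hnm as [|m Hnm IH]; [lra|].
rewrite sum_Sn; apply (Rle_trans _ _ _ IH); unfold plus; simpl; specialize (Hv (S m)); lra.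
Qed.

Definition cis (t : R) : C := (cos t, sin t).

Lemma cis_plus s t : cis (s + t) = (cis s * cis t)%C.
Proof.
unfold cis; rewrite cos_plus, sin_plus; apply injective_projections; simpl; ring.
Qed.

Lemma cis_0 : cis 0 = RtoC 1.
Proof. unfold cis; now rewrite cos_0, sin_0. Qed.

Lemma cis_pow t n : (cis t ^ n)%C = cis (INR n * t).
Proof.
induction n as [|n IH].
- simpl; now rewrite Rmult_0_l, cis_0.
- rewrite Cpow_S, IH, <- cis_plus; f_equal; rewrite S_INR; ring.
Qed.

Lemma Cconj_cis t : Cconj (cis t) = cis (- t).
Proof. unfold cis, Cconj; simpl; now rewrite cos_neg, sin_neg. Qed.

Lemma Cmod_cis t : Cmod (cis t) = 1.
Proof.
unfold cis, Cmod; simpl fst; simpl snd; now rewrite cos2_sin2, sqrt_1.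
Qed.

Lemma is_RInt_harmonic (w : C) n : (0 < n)%nat ->
  is_RInt (fun t => Re (w * cis (INR n * t))) 0 (2 * PI) 0.
Proof.
intros Hn; assert (Hn0 : INR n <> 0) by (apply not_0_INR; lia).
set (F := fun t => (Re w * sin (INR n * t) + Im w * cos (INR n * t)) / INR n).
replace 0 with (minus (F (2 * PI)) (F 0)) at 2.
- apply (is_RInt_derive F); intros t _.
  + unfold F, cis, Re, Im; simpl; auto_derive; [trivial|field; exact Hn0].
  + apply (ex_derive_continuous (V := R_NormedModule)).
    unfold cis, Re; simpl; auto_derive; trivial.
- unfold F, minus, plus, opp; simpl.
  replace (INR n * (2 * PI)) with (0 + 2 * INR n * PI) by ring.
  rewrite cos_period, sin_period, Rmult_0_r; ring.
Qed.

Definition trigpoly (c : nat -> C) (N : nat) (t : R) : C := Csum_n (fun k => c k * cis t ^ k)%C N.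

Lemma is_RInt_higher_harmonic (c : nat -> C) (w : C) (N m : nat) : (N < m)%nat ->
  is_RInt (fun t => Re (w * cis t ^ m * Cconj (trigpoly c N t))) 0 (2 * PI) 0.
Proof.
assert (Hterm : forall k, (k < m)%nat ->
  is_RInt (fun t => Re (w * cis t ^ m * Cconj (c k * cis t ^ k))) 0 (2 * PI) 0).
{ intros k Hk.
  apply (is_RInt_ext (fun t => Re (w * Cconj (c k) * cis (INR (m - k) * t)))).
  - intros t _; f_equal.
    rewrite Cmult_conj, Cpow_conj, Cconj_cis, !cis_pow.
    replace (INR (m - k) * t) with (INR m * t + INR k * - t) by (rewrite minus_INR by lia; ring).
    rewrite cis_plus; ring.
  - apply is_RInt_harmonic; lia. }
induction N as [|N IH]; intros HN.
- apply (is_RInt_ext (fun t => Re (w * cis t ^ m * Cconj (c O * cis t ^ O)))).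
  + intros t _; unfold trigpoly; now rewrite sum_O.
  + now apply Hterm.
- replace 0 with (plus 0 0) at 2 by (unfold plus; simpl; ring).
  refine (is_RInt_ext _ _ _ _ _ _ (is_RInt_plus _ _ _ _ _ _ (IH _) (Hterm (S N) HN))); [|lia].
  intros t _; unfold trigpoly; rewrite sum_Sn; unfold plus; simpl AbelianMonoid.plus.
  rewrite Cplus_conj, Cmult_plus_distr_l; reflexivity.
Qed.

(** By induction on the degree: the new term is orthogonal to all the previous ones. *)
Lemma Parseval_trigpoly (c : nat -> C) (N : nat) :
  is_RInt (fun t => Cmod (trigpoly c N t) ^ 2) 0 (2 * PI) (2 * PI * sum_n (fun k => Cmod (c k) ^ 2) N).
Proof.
assert (Hconst : forall x : R, is_RInt (fun _ => x) 0 (2 * PI) (2 * PI * x)).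
{ intros x; generalize (is_RInt_const (V := R_NormedModule) 0 (2 * PI) x).
  unfold scal; simpl; unfold mult; simpl; now rewrite Rminus_0_r. }
induction N as [|N IH].
- rewrite sum_O; apply (is_RInt_ext (fun _ => Cmod (c O) ^ 2)); [|apply Hconst].
  intros t _; unfold trigpoly; rewrite sum_O; simpl; now rewrite Cmult_1_r.
- rewrite sum_Sn.
  assert (H := is_RInt_plus _ _ _ _ _ _ (is_RInt_plus _ _ _ _ _ _ IH (Hconst (Cmod (c (S N)) ^ 2)))
    (is_RInt_scal _ _ _ 2 _ (is_RInt_higher_harmonic c (c (S N)) N (S N) (Nat.lt_succ_diag_r N)))).
  replace (2 * PI * plus (sum_n (fun k => Cmod (c k) ^ 2) N) (Cmod (c (S N)) ^ 2))
    with (2 * PI * sum_n (fun k => Cmod (c k) ^ 2) N + 2 * PI * Cmod (c (S N)) ^ 2 + 2 * 0)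
    by (unfold plus; simpl; ring).
  refine (is_RInt_ext _ _ _ _ _ _ H).
  intros t _; unfold plus, scal; simpl; unfold mult; simpl.
  change (Cmod (trigpoly c N t) ^ 2 + Cmod (c (S N)) ^ 2
    + 2 * Re (c (S N) * cis t ^ S N * Cconj (trigpoly c N t)) = Cmod (trigpoly c (S N) t) ^ 2).
  unfold trigpoly; rewrite sum_Sn; fold (trigpoly c N t).
  replace (Cmod (c (S N)) ^ 2) with (Cmod (c (S N) * cis t ^ S N) ^ 2)
    by (rewrite Cmod_mult, Cmod_pow, Cmod_cis, pow1; ring).
  generalize (c (S N) * cis t ^ S N)%C (trigpoly c N t); intros [x y] [u v].
  rewrite !Cmod2_alt; unfold plus, Re, Im, Cconj; simpl; ring.
Qed.

(** On the circle of radius rho the partial sums of the series are bounded by M plus a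
    uniform tail, which tends to 0. *)
Lemma Bessel_circle (a : nat -> C) (M rho : R) n : conv_disc a ->
  (forall z, unit_disc z -> Cmod (CPS a z) <= M) -> 0 <= rho < 1 ->
  sum_n (fun k => Cmod (a k * RtoC rho ^ k) ^ 2) n <= M ^ 2.
Proof.
intros Ha HM Hrho; assert (HPI := PI_RGT_0).
set (v := fun k => Cmod (a k) * rho ^ k).
assert (Hv : ex_series v) by (apply radius_ex_series; [now apply conv_disc_radius|exact Hrho]).
destruct Hv as [S HS].
set (T := fun N => S - sum_n v N).
assert (HT : is_lim_seq T 0).
{ replace (Finite 0) with (Finite (S - S)) by (f_equal; ring).
  apply is_lim_seq_minus'; [apply is_lim_seq_const|exact HS]. }
set (c := fun k => (a k * RtoC rho ^ k)%C).
apply (is_lim_seq_le (fun _ => sum_n (fun k => Cmod (c k) ^ 2) n) (fun N => (M + T (n + N)%nat) ^ 2)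
  (sum_n (fun k => Cmod (c k) ^ 2) n) (M ^ 2)).
2:{ apply is_lim_seq_const. }
2:{ replace (M ^ 2) with ((M + 0) * ((M + 0) * 1)) by ring.
    assert (H : is_lim_seq (fun N => M + T (n + N)%nat) (M + 0)).
    { apply is_lim_seq_plus'; [apply is_lim_seq_const|].
      apply (is_lim_seq_ext (fun N => T (N + n)%nat)); [intros; f_equal; lia|].
      now apply is_lim_seq_incr_n. }
    apply is_lim_seq_mult'; [exact H|]; apply is_lim_seq_mult'; [exact H|apply is_lim_seq_const]. }
intros N.
apply (Rle_trans _ (sum_n (fun k => Cmod (c k) ^ 2) (n + N))).
{ apply sum_n_incr; [intros; apply pow2_ge_0|lia]. }
apply (Rmult_le_reg_l (2 * PI)); [lra|].
assert (HP := Parseval_trigpoly c (n + N)).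
rewrite <- (is_RInt_unique _ _ _ _ HP).
replace (2 * PI * (M + T (n + N)%nat) ^ 2) with (RInt (fun _ => (M + T (n + N)%nat) ^ 2) 0 (2 * PI)).
2:{ rewrite RInt_const; unfold scal; simpl; unfold mult; simpl; ring. }
apply RInt_le; [lra|eexists; exact HP|apply ex_RInt_const|].
intros t _; apply pow_incr; split; [apply Cmod_ge_0|].
set (z := (RtoC rho * cis t)%C).
assert (Hz : unit_disc z).
{ unfold z, unit_disc; rewrite Cmod_mult, Cmod_cis, Cmod_R, Rabs_pos_eq; lra. }
assert (E : trigpoly c (n + N) t = Csum_n (fun k => a k * z ^ k)%C (n + N)).
{ apply sum_n_ext; intros k; unfold c, z; rewrite Cpow_mult_l; symmetry; apply Cmult_assoc. }
assert (Htail := Cmod_series_tail_le _ _ v S (n + N) (CPS_correct a z Ha Hz) HS).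
rewrite E.
replace (Csum_n (fun k => a k * z ^ k)%C (n + N)) with
  (CPS a z - (CPS a z - Csum_n (fun k => a k * z ^ k) (n + N)))%C by ring.
apply (Rle_trans _ _ _ (Cmod_triangle _ _)); rewrite Cmod_opp.
apply Rplus_le_compat; [now apply HM|apply Htail].
intros k; unfold v, z; rewrite Cmod_mult, Cmod_pow, Cmod_mult, Cmod_cis, Cmod_R, Rabs_pos_eq by lra.
rewrite Rmult_1_r; lra.
Qed.

Lemma Bessel_inequality (a : nat -> C) (M : R) n : conv_disc a ->
  (forall z, unit_disc z -> Cmod (CPS a z) <= M) ->
  sum_n (fun k => Cmod (a k) ^ 2) n <= M ^ 2.
Proof.
intros Ha HM.
set (h := fun x : R => sum_n (fun k => Cmod (a k) ^ 2 * (x ^ k) ^ 2) n).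
(* The bound holds on each circle of radius rho < 1; a finite sum is continuous in rho. *)
set (rho := fun N => 1 - / INR (S (S N))).
assert (Hrho : forall N, 0 <= rho N < 1).
{ intros N; unfold rho; assert (1 <= INR (S (S N))) by (rewrite !S_INR; generalize (pos_INR N); lra).
  assert (0 < / INR (S (S N)) <= 1); [|lra].
  split; [apply Rinv_0_lt_compat; lra|]; rewrite <- Rinv_1; apply Rinv_le_contravar; lra. }
assert (Hlim : is_lim_seq rho 1).
{ replace (Finite 1) with (Finite (1 - 0)) by (f_equal; ring).
  apply is_lim_seq_minus'; [apply is_lim_seq_const|].
  apply (is_lim_seq_inv _ p_infty); [|discriminate].
  apply (is_lim_seq_incr_1 (fun N => INR (S N))), (is_lim_seq_incr_1 INR), is_lim_seq_INR. }
apply (is_lim_seq_le (fun N => h (rho N)) (fun _ => M ^ 2) (sum_n (fun k => Cmod (a k) ^ 2) n) (M ^ 2)).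
- intros N; apply Rle_trans with (2 := Bessel_circle a M (rho N) n Ha HM (Hrho N)).
  right; apply sum_n_ext; intros k.
  rewrite Cmod_mult, Cmod_pow, Cmod_R, (Rabs_pos_eq (rho N)), Rpow_mult_distr by apply Hrho.
  reflexivity.
- replace (sum_n (fun k => Cmod (a k) ^ 2) n) with (h 1).
  + apply is_lim_seq_continuous; [|exact Hlim].
    apply continuity_pt_filterlim, (ex_derive_continuous (V := R_NormedModule)).
    apply (ex_derive_sum_n (K := R_AbsRing) (V := R_NormedModule)
       (fun k x => Cmod (a k) ^ 2 * (x ^ k) ^ 2)); intros k _; auto_derive; trivial.
  + apply sum_n_ext; intros k; rewrite !pow1; apply Rmult_1_r.
- apply is_lim_seq_const.
Qed.

Lemma bounded_ex_series (v : nat -> R) (B : R) : (forall k, 0 <= v k) ->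
  (forall n, sum_n v n <= B) -> ex_series v.
Proof.
intros Hv HB; apply (ex_finite_lim_seq_incr (sum_n v) B); [|exact HB].
intros n; apply sum_n_incr; [exact Hv|lia].
Qed.

Lemma sum_n_inv_squares n : sum_n (fun k => (/ INR (S k)) ^ 2) n <= 2 - / INR (S n).
Proof.
induction n as [|n IH].
- rewrite sum_O; simpl; lra.
- rewrite sum_Sn; apply (Rle_trans _ (2 - / INR (S n) + (/ INR (S (S n))) ^ 2)).
  + apply Rplus_le_compat_r, IH.
  + rewrite (S_INR (S n)); assert (0 < INR (S n)) by (apply lt_0_INR; lia).
    apply (Rplus_le_reg_r (/ INR (S n) - 2)); apply (Rmult_le_reg_r (INR (S n) * (INR (S n) + 1) ^ 2)).
    { apply Rmult_lt_0_compat; [lra|apply pow_lt; lra]. }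
    field_simplify; nra.
Qed.

(** Absolute convergence, from |a_k| / (k + 1) <= (|a_k|^2 + 1 / (k + 1)^2) / 2. *)
Lemma ex_Cseries_hilbert_coefficient (a : nat -> C) (M : R) n : conv_disc a ->
  (forall z, unit_disc z -> Cmod (CPS a z) <= M) ->
  ex_Cseries (fun k => a k / RtoC (INR (n + k + 1)))%C.
Proof.
intros Ha HM.
apply (ex_Cseries_le _ (fun k => / 2 * (Cmod (a k) ^ 2 + (/ INR (S k)) ^ 2))).
- intros k; assert (Hk : 0 < INR (S k)) by (apply lt_0_INR; lia).
  assert (Hnk : INR (S k) <= INR (n + k + 1)) by (apply le_INR; lia).
  rewrite Cmod_div, Cmod_R, Rabs_pos_eq by (try (apply pos_INR); intros E; apply RtoC_inj in E; lra).
  apply (Rle_trans _ (Cmod (a k) * / INR (S k))).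
  + apply Rmult_le_compat_l; [apply Cmod_ge_0|]; apply Rinv_le_contravar; lra.
  + generalize (pow2_ge_0 (Cmod (a k) - / INR (S k))); intros; nra.
- apply (ex_series_scal (V := R_NormedModule)), (ex_series_plus (V := R_NormedModule)).
  + apply (bounded_ex_series _ (M ^ 2)); [intros; apply pow2_ge_0|].
    intros m; now apply Bessel_inequality.
  + apply (bounded_ex_series _ 2); [intros; apply pow2_ge_0|].
    intros m; generalize (sum_n_inv_squares m) (Rinv_0_lt_compat (INR (S m)) (lt_0_INR _ (Nat.lt_0_succ m))); lra.
Qed.

Lemma in_Hinf_bounded (f : C -> C) : in_Hinf f ->
  exists M, forall z, unit_disc z -> Cmod (f z) <= M.
Proof.
intros [_ Hf].
assert (H0 : unit_disc (RtoC 0)) by (apply unit_disc_real; lra).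
unfold Hinf_norm in Hf.
destruct (Lub_Rbar_correct (fun x : R => exists z : C, unit_disc z /\ x = Cmod (f z))) as [Hub _].
destruct (Lub_Rbar _) as [M| |]; try easy.
- exists M; intros z Hz; apply (Hub (Cmod (f z))); now exists z.
- destruct (Hub (Cmod (f (RtoC 0)))); now exists (RtoC 0).
Qed.

Lemma hilbert_Hinf_exists (f : C -> C) (a : nat -> C) : in_Hinf f -> power_series_on_disc a f ->
  exists g : C -> C, is_hilbert f g /\ in_Zygmund g.
Proof.
intros Hf Hfa.
assert (Ha := power_series_conv_disc a f Hfa).
destruct (in_Hinf_bounded f Hf) as [M HM].
assert (HM' : forall z, unit_disc z -> Cmod (CPS a z) <= M).
{ intros z Hz; rewrite <- (power_series_CPS a f z); auto. }
set (b := fun n => Csum (fun k => a k / RtoC (INR (n + k + 1)))%C).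
assert (Hb : forall n, is_Cseries (fun k => a k / RtoC (INR (n + k + 1)))%C (b n)).
{ intros n; apply Csum_correct; now apply (ex_Cseries_hilbert_coefficient a M). }
assert (HM0 : 0 <= M).
{ apply (Rle_trans _ _ _ (Cmod_ge_0 (CPS a (RtoC 0)))), HM', unit_disc_real; lra. }
assert (Hcb : conv_disc b).
{ apply (bounded_conv_disc _ M); intros n; apply (Rle_trans _ (M / INR (S n))).
  - apply (Cmod_moment_le a b M n Ha (hilbert_coefficients_shift a b Hb)).
    intros t Ht; now apply HM', unit_disc_real.
  - assert (1 <= INR (S n)) by (rewrite S_INR; generalize (pos_INR n); lra).
    apply (Rmult_le_reg_r (INR (S n))); [lra|].
    unfold Rdiv; rewrite Rmult_assoc, Rinv_l by lra; nra. }
exists (CPS b).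
assert (Hh : is_hilbert f (CPS b)).
{ split; [apply Hf|split; [now apply analytic_CPS|]].
  exists a, b; split; [exact Hfa|split; [exact Hb|now apply CPS_power_series]]. }
split; [exact Hh|split; [now apply analytic_CPS|]].
apply (Rbar_le_lt_trans _ _ _ (Zygmund_norm_hilbert_le f _ M Hh HM)); exact I.
Qed.

(** * The lower bound *)

Lemma sum_arithmetic_geometric (w : C) N :
  (Csum_n (fun n => RtoC (INR n) * w ^ n)%C N * (1 - w) ^ 2 =
   w - w ^ S N * (RtoC (INR (S N)) - RtoC (INR N) * w))%C.
Proof.
induction N as [|N IH].
- rewrite sum_O; simpl; ring.
- rewrite sum_Sn; unfold plus; simpl (AbelianMonoid.plus _ _).
  rewrite Cmult_plus_distr_r, IH, !S_INR, !RtoC_plus; simpl; ring.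
Qed.

(** Termwise 2 u v <= lambda u^2 + v^2 / lambda. After multiplication by 1 - r^2 the bound is
    lambda + 2 (1 - r^2) / lambda, small for a small lambda and r close to 1. *)
Lemma sum_geometric_over_linear_le (r lambda : R) N : 0 <= r < 1 -> 0 < lambda ->
  sum_n (fun n => 2 * r ^ n / INR (n + 3)) N <= lambda / (1 - r ^ 2) + 2 / lambda.
Proof.
intros Hr Hl.
apply (Rle_trans _ (sum_n (fun n => plus (lambda * (r ^ 2) ^ n) (/ lambda * (/ INR (S n)) ^ 2)) N)).
- apply sum_n_m_le; intros n.
  change (2 * r ^ n / INR (n + 3) <= lambda * (r ^ 2) ^ n + / lambda * (/ INR (S n)) ^ 2).
  assert (Hn : 0 < INR (S n)) by (apply lt_0_INR; lia).
  assert (Hn3 : INR (S n) <= INR (n + 3)) by (apply le_INR; lia).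
  rewrite <- pow_mult, Nat.mul_comm, pow_mult.
  assert (Hrn : 0 <= r ^ n) by (apply pow_le; lra).
  apply (Rle_trans _ (2 * r ^ n * / INR (S n))).
  { apply Rmult_le_compat_l; [lra|]; apply Rinv_le_contravar; lra. }
  assert (E : lambda * (r ^ n) ^ 2 + / lambda * (/ INR (S n)) ^ 2 - 2 * r ^ n * / INR (S n)
     = / lambda * (lambda * r ^ n - / INR (S n)) ^ 2) by (field; lra).
  assert (0 <= / lambda * (lambda * r ^ n - / INR (S n)) ^ 2).
  { apply Rmult_le_pos; [left; now apply Rinv_0_lt_compat|apply pow2_ge_0]. }
  lra.
- rewrite sum_n_plus; apply Rplus_le_compat.
  + assert (Hr2 : 0 <= r ^ 2 < 1) by (simpl; nra).
    rewrite (sum_n_mult_l (K := R_Ring)); apply Rmult_le_compat_l; [lra|].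
    apply (is_lim_seq_incr_compare (sum_n (fun n => (r ^ 2) ^ n))).
    * apply is_series_geom; rewrite Rabs_pos_eq; lra.
    * intros n; apply sum_n_incr; [intros; apply pow_le; lra|lia].
  + rewrite (sum_n_mult_l (K := R_Ring)); unfold Rdiv; rewrite (Rmult_comm 2); apply Rmult_le_compat_l.
    { left; now apply Rinv_0_lt_compat. }
    apply (Rle_trans _ _ _ (sum_n_inv_squares N)).
    generalize (Rinv_0_lt_compat (INR (S N)) (lt_0_INR _ (Nat.lt_0_succ N))); lra.
Qed.

(** The coefficients of the image of the constant function 1. *)
Definition reciprocals (n : nat) : C := RtoC (/ INR (S n)).

(** (n+1) (n+2) / (n+3) = n + 2 / (n+3), which splits the second derivative into
    z / (1 - z)^2 and a remainder of logarithmic growth. *)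
Lemma reciprocals_second_coefficient n :
  Cderiv (Cderiv reciprocals) n = (RtoC (INR n) + RtoC (2 / INR (n + 3)))%C.
Proof.
unfold Cderiv, reciprocals; rewrite <- !RtoC_mult, <- RtoC_plus; f_equal.
rewrite plus_INR, !S_INR; simpl INR; generalize (pos_INR n); intros; field; lra.
Qed.

Lemma conv_disc_reciprocals : conv_disc reciprocals.
Proof.
apply (bounded_conv_disc _ 1); intros n; unfold reciprocals; rewrite Cmod_R.
assert (1 <= INR (S n)) by (rewrite S_INR; generalize (pos_INR n); lra).
rewrite Rabs_pos_eq by (left; apply Rinv_0_lt_compat; lra).
rewrite <- Rinv_1; apply Rinv_le_contravar; lra.
Qed.

(** Proved on partial sums: the part sum n z^n is summed in closed form, the remainder is bounded
    termwise. *)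
Lemma Cmod_reciprocals_ge (z : C) (r lambda : R) : Cmod z = r -> 0 <= r < 1 -> 0 < lambda ->
  r / Cmod (1 - z) ^ 2 - (lambda / (1 - r ^ 2) + 2 / lambda)
   <= Cmod (CPS (Cderiv (Cderiv reciprocals)) z).
Proof.
intros Hz Hr Hl.
assert (Hzd : unit_disc z) by (unfold unit_disc; lra).
assert (Hd := Cmod_1_minus_pos z Hzd).
assert (Hd2 := pow_lt _ 2 Hd).
assert (HS := CPS_correct _ z (conv_disc_Cderiv _ (conv_disc_Cderiv _ conv_disc_reciprocals)) Hzd).
set (tau := fun N => INR (S (S N)) * INR (S (S (S N))) * r ^ S N).
assert (Htau := quadratic_geometric_lim_0 r Hr); fold tau in Htau.
apply (is_lim_seq_le (fun N => (r - tau N) / Cmod (1 - z) ^ 2 - (lambda / (1 - r ^ 2) + 2 / lambda)) _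
  (r / Cmod (1 - z) ^ 2 - (lambda / (1 - r ^ 2) + 2 / lambda)) (Cmod (CPS (Cderiv (Cderiv reciprocals)) z)))
  with (3 := is_lim_seq_Cmod _ _ HS).
2:{ apply is_lim_seq_minus'; [|apply is_lim_seq_const].
    replace (r / Cmod (1 - z) ^ 2) with ((r - 0) / Cmod (1 - z) ^ 2) by (f_equal; ring).
    apply is_lim_seq_mult'; [|apply is_lim_seq_const].
    apply is_lim_seq_minus'; [apply is_lim_seq_const|exact Htau]. }
intros N.
set (P := Csum_n (fun n => RtoC (INR n) * z ^ n)%C N).
set (Q := Csum_n (fun n => RtoC (2 / INR (n + 3)) * z ^ n)%C N).
replace (Csum_n (fun n => Cderiv (Cderiv reciprocals) n * z ^ n)%C N) with (P + Q)%C.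
2:{ unfold P, Q; rewrite <- (sum_n_plus (G := C_AbelianMonoid)); apply sum_n_ext; intros n.
    rewrite reciprocals_second_coefficient; symmetry; apply Cmult_plus_distr_r. }
assert (HQ : Cmod Q <= lambda / (1 - r ^ 2) + 2 / lambda).
{ apply Rle_trans with (2 := sum_geometric_over_linear_le r lambda N Hr Hl).
  apply Cmod_sum_n_le; intros n; rewrite Cmod_mult, Cmod_pow, Hz, Cmod_R, Rabs_pos_eq.
  - right; unfold Rdiv; ring.
  - left; apply Rdiv_lt_0_compat; [lra|apply lt_0_INR; lia]. }
assert (HP : (r - tau N) / Cmod (1 - z) ^ 2 <= Cmod P).
{ apply (Rmult_le_reg_r (Cmod (1 - z) ^ 2) _ _ Hd2).
  unfold Rdiv; rewrite Rmult_assoc, Rinv_l, Rmult_1_r by lra.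
  rewrite <- Cmod_pow, <- Cmod_mult; unfold P; rewrite sum_arithmetic_geometric.
  set (R := (z ^ S N * (RtoC (INR (S N)) - RtoC (INR N) * z))%C).
  assert (HR : Cmod R <= tau N).
  { unfold R, tau; rewrite Cmod_mult, Cmod_pow, Hz, Rmult_comm.
    apply Rmult_le_compat_r; [apply pow_le; lra|].
    apply (Rle_trans _ _ _ (Cmod_triangle _ _)).
    rewrite Cmod_opp, Cmod_mult, !Cmod_R, !(Rabs_pos_eq (INR _)), Hz by apply pos_INR.
    rewrite !S_INR; generalize (pos_INR N); intros; nra. }
  generalize (Cmod_triangle (z - R) R).
  replace (z - R + R)%C with z by ring; rewrite Hz; lra. }
generalize (Cmod_reverse_triangle P Q); lra.
Qed.

Lemma sin_sqr_le x : sin x ^ 2 <= x ^ 2.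
Proof.
assert (H : forall y, 0 < y -> Rabs (sin y) <= y).
{ intros y Hy; destruct (Rle_dec y PI) as [Hp|Hp].
  - rewrite Rabs_pos_eq by (apply sin_ge_0; lra); left; now apply sin_lt_x.
  - apply Rabs_le; generalize (SIN_bound y) PI2_1; intros; lra. }
destruct (Rtotal_order x 0) as [Hx|[->|Hx]].
- rewrite <- (pow2_abs x), <- (pow2_abs (sin x)), <- (Rabs_Ropp (sin x)), <- sin_neg.
  apply pow_incr; split; [apply Rabs_pos|]; rewrite (Rabs_left x Hx); apply H; lra.
- rewrite sin_0; lra.
- rewrite <- (pow2_abs (sin x)); apply pow_incr; split; [apply Rabs_pos|now apply H].
Qed.

Lemma Cmod_1_minus_circle_le (r th : R) : 0 < r < 1 ->
  Cmod (1 - (r * cos th, r * sin th)) ^ 2 <= (1 - r) ^ 2 + th ^ 2.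
Proof.
intros Hr; rewrite chord_Cmod; unfold chord.
rewrite <- Rsqr_pow2, Rsqr_sqrt by (left; now apply chord_radicand_pos).
generalize (cos2_sin2 (th / 2)) (sin_sqr_le (th / 2)) (pow2_ge_0 (sin (th / 2))); intros E Hs Hs0.
replace (cos (th / 2) ^ 2) with (1 - sin (th / 2) ^ 2) by lra.
replace ((th / 2) ^ 2) with (th ^ 2 / 4) in Hs by field.
nra.
Qed.

Lemma is_RInt_cauchy (a x y : R) : 0 < a ->
  is_RInt (fun t => / (a ^ 2 + t ^ 2)) x y ((atan (y / a) - atan (x / a)) / a).
Proof.
intros Ha; set (F := fun t => atan (t / a) / a).
replace ((atan (y / a) - atan (x / a)) / a) with (minus (F y) (F x))
  by (unfold F, minus, plus, opp; simpl; field; lra).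
assert (HD : forall t, 0 < a ^ 2 + t ^ 2).
{ intros t; generalize (pow_lt a 2 Ha) (pow2_ge_0 t); lra. }
apply (is_RInt_derive F); intros t _; specialize (HD t).
- unfold F; auto_derive; [trivial|]; unfold Rsqr; field; repeat split; try lra; nra.
- apply (ex_derive_continuous (V := R_NormedModule)); auto_derive; simpl in HD; lra.
Qed.

Lemma atan_ge (x : R) : 0 < x -> PI / 2 - / x <= atan x.
Proof.
intros Hx; rewrite <- (Rinv_inv x) at 2; rewrite atan_inv by (now apply Rinv_0_lt_compat).
assert (H : forall y, 0 < y -> atan y <= y).
{ intros y Hy; destruct (MVT_gen atan 0 y (fun t => / (1 + t ^ 2))) as [c [_ E]].
  - intros t _; auto_derive; [trivial|]; unfold Rsqr; field; nra.
  - intros t _; apply derivable_continuous_pt, derivable_pt_atan.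
  - rewrite atan_0, !Rminus_0_r in E; rewrite E.
    assert (/ (1 + c ^ 2) <= 1).
    { rewrite <- Rinv_1; apply Rinv_le_contravar; [lra|generalize (pow2_ge_0 c); lra]. }
    nra. }
generalize (H (/ x) (Rinv_0_lt_compat x Hx)); lra.
Qed.

(** On each half circle |1 - r e^(i th)|^2 is at most (1 - r)^2 + th^2, with th measured from
    the nearest multiple of 2 pi, and the integral of the reciprocal is an arctangent. *)
Lemma RInt_circle_ge (h : R -> R) (r K : R) : 0 < r < 1 ->
  (forall th : R, continuous h th) ->
  (forall th, r / Cmod (1 - (r * cos th, r * sin th)) ^ 2 - K <= h th) ->
  2 * r * (PI / 2 - (1 - r) / PI) / (1 - r) - 2 * PI * K <= RInt h 0 (2 * PI).
Proof.
intros Hr Hcont Hh; assert (HPI := PI_RGT_0).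
assert (Hex : forall a b, ex_RInt h a b).
{ intros; apply (ex_RInt_continuous (V := R_CompleteNormedModule)); auto. }
rewrite <- (RInt_Chasles h 0 PI (2 * PI)) by apply Hex.
assert (Hh' : forall th phi, cos th = cos phi -> sin th = sin phi ->
   r * / ((1 - r) ^ 2 + phi ^ 2) - K <= h th).
{ intros th phi Ec Es; apply Rle_trans with (2 := Hh th).
  apply Rplus_le_compat_r, Rmult_le_compat_l; [lra|]; apply Rinv_le_contravar.
  - apply pow_lt, Cmod_1_minus_pos, unit_disc_circle; lra.
  - rewrite Ec, Es; now apply Cmod_1_minus_circle_le. }
set (F := fun t => r * / ((1 - r) ^ 2 + t ^ 2) - K).
assert (HF : forall x y, is_RInt F x y (r * ((atan (y / (1 - r)) - atan (x / (1 - r))) / (1 - r)) - (y - x) * K)).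
{ intros x y; apply (is_RInt_minus (V := R_NormedModule)).
  - apply (is_RInt_scal (V := R_NormedModule)), is_RInt_cauchy; lra.
  - apply (is_RInt_const (V := R_NormedModule)). }
assert (Hat := atan_ge (PI / (1 - r)) ltac:(apply Rdiv_lt_0_compat; lra)).
assert (H1 : r * ((PI / 2 - (1 - r) / PI) / (1 - r)) - PI * K <= RInt h 0 PI).
{ apply Rle_trans with (RInt F 0 PI).
  - rewrite (is_RInt_unique _ _ _ _ (HF 0 PI)).
    rewrite Rdiv_0_l, atan_0, !Rminus_0_r.
    apply Rplus_le_compat_r, Rmult_le_compat_l; [lra|].
    apply Rmult_le_compat_r; [left; apply Rinv_0_lt_compat; lra|].
    rewrite Rinv_div in Hat; exact Hat.
  - apply RInt_le; [lra|eexists; apply HF|apply Hex|]; intros t _; now apply Hh'. }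
assert (H2 : r * ((PI / 2 - (1 - r) / PI) / (1 - r)) - PI * K <= RInt h PI (2 * PI)).
{ assert (HFc : is_RInt (fun t => F (1 * t + - (2 * PI))) PI (2 * PI)
     (r * ((atan (0 / (1 - r)) - atan (- PI / (1 - r))) / (1 - r)) - (0 - - PI) * K)).
  { apply (is_RInt_ext (fun t => scal 1 (F (1 * t + - (2 * PI))))).
    { intros t _; apply Rmult_1_l. }
    apply (is_RInt_comp_lin F 1 (- (2 * PI)) PI (2 * PI)).
    replace (1 * PI + - (2 * PI)) with (- PI) by ring.
    replace (1 * (2 * PI) + - (2 * PI)) with 0 by ring.
    apply HF. }
  apply Rle_trans with (RInt (fun t => F (1 * t + - (2 * PI))) PI (2 * PI)).
  - rewrite (is_RInt_unique _ _ _ _ HFc).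
    replace (- PI / (1 - r)) with (- (PI / (1 - r))) by (field; lra).
    rewrite Rdiv_0_l, atan_0, atan_opp.
    replace (0 - - atan (PI / (1 - r))) with (atan (PI / (1 - r))) by ring.
    replace (0 - - PI) with PI by ring.
    apply Rplus_le_compat_r, Rmult_le_compat_l; [lra|].
    apply Rmult_le_compat_r; [left; apply Rinv_0_lt_compat; lra|].
    rewrite Rinv_div in Hat; exact Hat.
  - apply RInt_le; [lra|eexists; exact HFc|apply Hex|]; intros t _; apply Hh'.
    + rewrite <- (cos_period (1 * t + - (2 * PI)) 1); f_equal; simpl; ring.
    + rewrite <- (sin_period (1 * t + - (2 * PI)) 1); f_equal; simpl; ring. }
apply (Rle_trans _ ((r * ((PI / 2 - (1 - r) / PI) / (1 - r)) - PI * K)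
  + (r * ((PI / 2 - (1 - r) / PI) / (1 - r)) - PI * K))).
- right; field; lra.
- apply Rplus_le_compat; assumption.
Qed.

Lemma constant_one_power_series :
  power_series_on_disc (fun n => match n with O => RtoC 1 | S _ => RtoC 0 end) (fun _ => RtoC 1).
Proof.
intros z Hz; apply is_pseries_Cseries.
apply is_Cseries_single; [apply Cmult_1_l|intros n; apply Cmult_0_l].
Qed.

Lemma is_hilbert_one : is_hilbert (fun _ => RtoC 1) (CPS reciprocals).
Proof.
split; [intros z _; apply ex_derive_const|].
split; [apply analytic_CPS, conv_disc_reciprocals|].
eexists; exists reciprocals; split; [exact constant_one_power_series|].
split; [|apply CPS_power_series, conv_disc_reciprocals].
intros n; apply is_Cseries_single; [|intros k; apply Cmult_0_l].
unfold reciprocals; rewrite RtoC_inv by (apply not_0_INR; lia).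
replace (n + 0 + 1)%nat with (S n) by lia; apply Cmult_1_l.
Qed.

Lemma Hinf_norm_one_le : Rbar_le (Hinf_norm (fun _ => RtoC 1)) 1.
Proof.
apply Lub_Rbar_correct; intros x [z [_ ->]]; rewrite Cmod_1; simpl; lra.
Qed.

Lemma Zygmund_norm_reciprocals_ge : Rbar_le (3 / 2 + 2 / PI) (Zygmund_norm (CPS reciprocals)).
Proof.
assert (Hc := conv_disc_reciprocals).
assert (Hc1 := conv_disc_Cderiv _ Hc).
assert (Hc2 := conv_disc_Cderiv _ Hc1).
assert (Hg1 : forall w, unit_disc w -> C_derive (CPS reciprocals) w = CPS (Cderiv reciprocals) w)
  by (intros; now apply C_derive_CPS).
assert (Hg2 : forall w, unit_disc w ->
  C_derive (C_derive (CPS reciprocals)) w = CPS (Cderiv (Cderiv reciprocals)) w)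
  by (intros; now apply C_derive_CPS).
assert (HPI := PI_RGT_0).
assert (HPI3 : 3 < PI) by (generalize PI2_3_2; lra).
change (Finite (3 / 2 + 2 / PI)) with (Rbar_plus (3 / 2) (2 / PI)).
apply Rbar_plus_le_compat.
- rewrite Hg1, !CPS_0 by (apply unit_disc_real; lra).
  unfold Cderiv, reciprocals; rewrite <- RtoC_mult, !Cmod_R; simpl.
  rewrite !Rabs_pos_eq; lra.
(* With lambda = 1/10 the weighted mean is at least about r - 1/10 - 20 (1 - r^2),
   which exceeds 2/pi for every r close enough to 1. *)
- set (r := 999 / 1000).
  assert (Hr : 0 < r < 1) by (unfold r; lra).
  set (h := fun t => Cmod (CPS (Cderiv (Cderiv reciprocals)) (r * cos t, r * sin t))).
  set (K := / 10 / (1 - r ^ 2) + 2 / / 10).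
  apply (Rbar_le_trans _ ((1 - r ^ 2) * M1 r (C_derive (C_derive (CPS reciprocals))))).
  2:{ apply Lub_Rbar_correct; exists r; split; [exact Hr|reflexivity]. }
  unfold M1; rewrite (RInt_ext _ h).
  2:{ intros t _; unfold h; rewrite Hg2; [reflexivity|apply unit_disc_circle; lra]. }
  assert (HI : 2 * r * (PI / 2 - (1 - r) / PI) / (1 - r) - 2 * PI * K <= RInt h 0 (2 * PI)).
  { apply RInt_circle_ge; [exact Hr| |].
    - intros t; apply continuous_Cmod_CPS_circle; [exact Hc2|lra].
    - intros t; apply Cmod_reciprocals_ge; [apply Cmod_circle|..]; lra. }
  simpl Rbar_le.
  apply (Rle_trans _ ((1 - r ^ 2) * (/ (2 * PI) * (2 * r * (PI / 2 - (1 - r) / PI) / (1 - r) - 2 * PI * K)))).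
  + assert (E : (1 - r ^ 2) * (/ (2 * PI) * (2 * r * (PI / 2 - (1 - r) / PI) / (1 - r) - 2 * PI * K))
      = (1 + r) * r * (/ 2 - (1 - r) * (/ PI * / PI)) - (/ 10 + (1 - r ^ 2) * 20)).
    { assert (1 - r ^ 2 <> 0) by (unfold r; lra).
      unfold K; field; repeat split; try assumption; lra. }
    rewrite E; unfold r.
    assert (H3 : / PI < / 3) by (apply Rinv_lt_contravar; lra).
    assert (H0 := Rinv_0_lt_compat _ HPI); unfold Rdiv at 1; nra.
  + apply Rmult_le_compat_l; [nra|]; apply Rmult_le_compat_l; [|exact HI].
    left; apply Rinv_0_lt_compat; lra.
Qed.

(** * The norm estimate *)

Theorem theorem1p2 :
  (forall (f : C -> C) (a : nat -> C),
     in_Hinf f -> power_series_on_disc a f ->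
     exists g : C -> C, is_hilbert f g /\ in_Zygmund g) /\
  Rbar_le (Finite (3 / 2 + 2 / PI)) hilbert_norm_Hinf_Zygmund /\
  Rbar_le hilbert_norm_Hinf_Zygmund (Finite (3 / 2 + 4 / PI)).
Proof.
split; [exact hilbert_Hinf_exists|].
unfold hilbert_norm_Hinf_Zygmund, Rbar_lub.
match goal with |- context [Rbar_ex_lub ?E] => destruct (Rbar_ex_lub E) as [L [Hub Hleast]] end.
cbn [proj1_sig].
split.
- apply (Rbar_le_trans _ _ _ Zygmund_norm_reciprocals_ge), Hub.
  exists (fun _ => RtoC 1), (CPS reciprocals).
  assert (H1 := Hinf_norm_one_le); assert (Hh := is_hilbert_one).
  repeat split; try apply Hh; try exact H1.
  apply (Rbar_le_lt_trans _ _ _ H1); exact I.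
- apply Hleast; intros N [f [g [_ [Hf [Hh ->]]]]].
  rewrite <- (Rmult_1_l (3 / 2 + 4 / PI)).
  apply (Zygmund_norm_hilbert_le f g 1 Hh); intros z Hz.
  apply (Rbar_le_trans (Cmod (f z)) (Hinf_norm f) 1); [|exact Hf].
  apply Lub_Rbar_correct; now exists z.
Qed.
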